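(* Let the $s$-stage implicit Peer method $w_n = Pw_{n-1}+\triangle t_n Q_nF(w_{n-1})+\triangle t_n RF(w_n)$ defined by the coefficients $(c,P,Q_n,R)$, with $$Q_n=\left((CV_0-RV_0D)S_n-\tfrac{1}{\sigma_n}P(C-I)V_1\right)(V_1D)^{-1},$$ be zero-stable and suppose its stage order is equal to $s$. Let the initial values satisfy $w_{0,i}-u(t_0+c_i\triangle t_0)=\mathcal{O}(\triangle t_0^{s+1})$, $i=1,\ldots,s$, and let $\triangle t_{i-1}=(1+\mathcal{O}(\triangle t_{max}))\triangle t_i$, $i=1,\ldots,n$. Then the IMEX-Peer method $$w_n=Pw_{n-1}+\triangle t_n\left(\hat Q_nF_0(w_{n-1})+\hat RF_0(w_n)+Q_nF_1(w_{n-1})+RF_1(w_n)\right),\qquad \hat Q_n=Q_n+RE_{1,n},\quad \hat R=RE_2,$$ applied to $u'(t)=F_0(u(t))+F_1(u(t))$, is convergent of order $s+1$, i.e., the global error $\varepsilon_n=w(t_n)-w_n$ satisfies $\varepsilon_n=\mathcal{O}(\triangle t_{max}^{s+1})$, if for all $v\in\mathbb{R}^s$ with $(I-P^T)v=0$ the following conditions are satisfied: $$v^T(C-I)V_1\tilde{D}V_1^{-1}(c-e)^s=0,$$ $$v^T\left(c^j-jRc^{j-1}\right)=0,\qquad j=2,\ldots,s+1,$$ $$v^TR(E_2-I)c^{j-1}=0,\qquad j=2,\ldots,s+1.$$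
   Context: Problem: $u'(t)=F(u(t))=F_0(u(t))+F_1(u(t))$, $u(0)=u_0\in\mathbb{R}^m$, on a fixed bounded time interval, where $F_0,F_1:\mathbb{R}^m\to\mathbb{R}^m$ are sufficiently often differentiable and Lipschitz continuous and the solution $u$ is sufficiently smooth. Grid: step sizes $\triangle t_n>0$, $t_0=0$, $t_n=\triangle t_0+\ldots+\triangle t_{n-1}$, step size ratios $\sigma_n=\triangle t_n/\triangle t_{n-1}$ with $0\le\sigma_{min}<\sigma_n<\sigma_{max}$, and $\triangle t_{max}=\max_{i=0,\ldots,n}\triangle t_i$. All $\mathcal{O}$-constants are uniform in $n$ (for $t_n$ in the bounded time interval), in $i$ and in the step sizes, as $\triangle t_{max}\to 0$; they may depend on $F_0$, $F_1$ and $u$. Method: $w_n=[w_{n,1}^T,\ldots,w_{n,s}^T]^T\in\mathbb{R}^{ms}$ with $w_{n,i}\approx u(t_n+c_i\triangle t_n)$; the nodes $c_i\in\mathbb{R}$ are pairwise distinct and $c_s=1$; $F(w)=[F(w_i)]$ (likewise $F_0,F_1$) is applied componentwise. An $s\times s$ matrix $A$ acting on $\mathbb{R}^{ms}$ means $A\otimes I_m$. $P,R,E_2$ are constant $s\times s$ matrices, $R$ lower triangular with constant diagonal $r_{ii}=\gamma>0$, $E_2$ strictly lower triangular, and $E_{1,n}=(I-E_2)V_0S_nV_1^{-1}$. The exact values are $w(t_n)=[u(t_n+c_i\triangle t_n)]_{i=1}^s$. Notation: $e=(1,\ldots,1)^T$, $c=(c_1,\ldots,c_s)^T$, powers of vectors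 are componentwise (with $0^0=1$), $V_0=(c_i^{j-1})_{i,j=1}^s$, $V_1=((c_i-1)^{j-1})_{i,j=1}^s$, $C=\mathrm{diag}(c_1,\ldots,c_s)$, $D=\mathrm{diag}(1,2,\ldots,s)$, $\tilde D=(s+1)D^{-1}-I$, $S_n=\mathrm{diag}(1,\sigma_n,\ldots,\sigma_n^{s-1})$. Zero-stable means that $P$ is power bounded ($\sup_{k\ge0}\|P^k\|<\infty$). With $$d_{n,j}=\frac{1}{j!}\left(c^j-\frac{1}{\sigma_n^j}P(c-e)^j-\frac{j}{\sigma_n^{j-1}}Q_n(c-e)^{j-1}-jRc^{j-1}\right),$$ the implicit method has stage order $q$ if it is pre-consistent ($Pe=e$) and $d_{n,j}=0$ for all $\sigma_n$ and $j=1,\ldots,q$. *)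

(* Defs.v *)
From HB Require Import structures.
From mathcomp Require Import all_boot all_order all_algebra.
From mathcomp Require Import all_classical all_reals all_analysis.

Set Implicit Arguments.
Unset Strict Implicit.
Unset Printing Implicit Defensive.

Import Order.TTheory GRing.Theory Num.Theory.
Import numFieldNormedType.Exports.

Local Open Scope classical_set_scope.
Local Open Scope ring_scope.

(* f is k times continuously differentiable on the set U, meant to be open:
   every iterated directional derivative of order < k is Frechet differentiable
   on U, and those of order k are continuous there. *)
Fixpoint cont_diff (K : realType) (V W : normedModType K) (k : nat)
    (U : set V) (f : V -> W) : Prop :=
  match k with
  | 0%N => forall x, U x -> {for x, continuous f}
  | k'.+1 => (forall x, U x -> differentiable f x) /\
             (forall v, cont_diff k' U (fun x => 'D_v f x))
  end.

Section Coefficients.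
Variables (K : realType) (s : nat).
Implicit Types (x c : 'cV[K]_s) (P Q R : 'M[K]_s) (sigma : K).

Definition ones : 'cV[K]_s := const_mx 1.

Definition cpow x (j : nat) : 'cV[K]_s := \col_i x i 0 ^+ j.

(* Indices in 'I_s start at 0: the j-th column of V0, V1 carries the power j and
   the j-th diagonal entry of D is j + 1. *)
Definition V0 c : 'M[K]_s := \matrix_(i, j) c i 0 ^+ j.
Definition V1 c : 'M[K]_s := \matrix_(i, j) (c i 0 - 1) ^+ j.
Definition Cmx c : 'M[K]_s := diag_mx c^T.
Definition Dmx : 'M[K]_s := diag_mx (\row_j j.+1%:R).
Definition Dtilde : 'M[K]_s := s.+1%:R *: invmx Dmx - 1%:M.
Definition Smx sigma : 'M[K]_s := diag_mx (\row_j sigma ^+ j).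

Definition peerQ c P R sigma : 'M[K]_s :=
  ((Cmx c *m V0 c - R *m V0 c *m Dmx) *m Smx sigma
    - sigma^-1 *: (P *m (Cmx c - 1%:M) *m V1 c)) *m invmx (V1 c *m Dmx).

Definition extrapE1 c (E2 : 'M[K]_s) sigma : 'M[K]_s :=
  (1%:M - E2) *m V0 c *m Smx sigma *m invmx (V1 c).

Definition Qhat c P R (E2 : 'M[K]_s) sigma : 'M[K]_s :=
  peerQ c P R sigma + R *m extrapE1 c E2 sigma.

Definition Rhat R (E2 : 'M[K]_s) : 'M[K]_s := R *m E2.

Definition zero_stable P := exists M : K, forall k : nat, `|P ^+ k| <= M.

(* d_{n,j}, for j >= 1, as a function of the step size ratio sigma; Q is the
   coefficient matrix Q_n at that ratio. *)
Definition defect c P Q R sigma (j : nat) : 'cV[K]_s :=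
  (j`!%:R)^-1 *:
    (cpow c j
      - (sigma ^+ j)^-1 *: (P *m cpow (c - ones) j)
      - (j%:R / sigma ^+ j.-1) *: (Q *m cpow (c - ones) j.-1)
      - j%:R *: (R *m cpow c j.-1)).

Definition stage_order c P (Q : K -> 'M[K]_s) R (sigma_min sigma_max : K)
    (q : nat) : Prop :=
  P *m ones = ones /\
  forall sigma, sigma_min < sigma < sigma_max ->
  forall j : nat, (1 <= j <= q)%N -> defect c P (Q sigma) R sigma j = 0.

End Coefficients.

Section Grid.
Variables (K : realType) (dt : nat -> K).

Definition tgrid (n : nat) : K := \sum_(i < n) dt i.
Definition step_ratio (n : nat) : K := dt n / dt n.-1.
Definition dtmax (n : nat) : K := \big[Num.max/dt 0%N]_(i < n.+1) dt i.

End Grid.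

(* An element of R^{ms} is an s x m matrix whose i-th row is the (transposed)
   i-th stage; A (x) I_m then acts as left multiplication by A. *)
Section Method.
Variables (K : realType) (s m : nat).
Implicit Types (c : 'cV[K]_s) (P R : 'M[K]_s) (w : nat -> 'M[K]_(s, m)).

Definition stagewise (F : 'rV[K]_m -> 'rV[K]_m) (w : 'M[K]_(s, m)) :
    'M[K]_(s, m) :=
  \matrix_(i < s) F (row i w).

Definition exact_stages (u : K -> 'rV[K]_m) c (dt : nat -> K) (n : nat) :
    'M[K]_(s, m) :=
  \matrix_(i < s) u (tgrid dt n + c i 0 * dt n).

(* The n-th step of the IMEX-Peer method, for n >= 1. *)
Definition imex_peer_step c P R (E2 : 'M[K]_s) (F0 F1 : 'rV[K]_m -> 'rV[K]_m)
    (dt : nat -> K) w (n : nat) : Prop :=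
  w n = P *m w n.-1 + dt n *:
    (Qhat c P R E2 (step_ratio dt n) *m stagewise F0 (w n.-1)
     + Rhat R E2 *m stagewise F0 (w n)
     + peerQ c P R (step_ratio dt n) *m stagewise F1 (w n.-1)
     + R *m stagewise F1 (w n)).

End Method.

(* Main.v *)
Require Import Defs.
From HB Require Import structures.
From mathcomp Require Import all_boot all_order all_algebra.
From mathcomp Require Import all_classical all_reals all_analysis.
From mathcomp Require Import ring lra.
Import Order.TTheory GRing.Theory Num.Theory.
Import numFieldNormedType.Exports.
Local Open Scope classical_set_scope.
Local Open Scope ring_scope.

Set Implicit Arguments.
Unset Strict Implicit.
Unset Printing Implicit Defensive.

(* The local error of the IMEX-Peer scheme is dt_n^(s+1) (A(sigma_n) u^(s+1)(t_n)
   + B(sigma_n) g^(s)(t_n)) + O(dt_n^(s+2)), where g = F0 o u and A, B are smooth in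
   the step size ratio, which is 1 + O(dt_max).  The three conditions say that A(1)
   and B(1) are annihilated by the left null vectors of I - P, i.e. lie in the range
   of I - P.  Hence the leading local error is dt_n^(s+1) (I - P) eta_n for a
   Lipschitz function eta of t_n, and subtracting dt_n^(s+1) eta_n from the global
   error leaves a recursion with local errors O(dt_n dt_max^(s+1)); zero-stability
   and a Gronwall argument conclude. *)

(** * Matrix norms *)

(** Both stage vectors are expanded about the new grid point [t_n]: the old stages sit at
    [t_n + (c_i - 1) dt_n / sigma_n], so [defect] appears directly as a Taylor coefficient. An IMEX
    step differs from the implicit step for [F0 + F1] only by [dt_n R] times the error of
    extrapolating [F0]; this is why [u] and [F0 o u] alone enter the expansion. The conditions start
    at [j = 2], and the gap at [j = 1] is closed by [c_s = 1]: since 0 is then one of the nodes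
    [c_i - 1], the interpolant of [x^s] has no constant term, and the uncontrolled column is
    multiplied by zero. Two constraints shape the estimates. The final constants are fixed before
    the grid is known, so local errors are bounded uniformly over all triples (time, step, ratio) in
    a parameter set, not along one grid. And zero-stability bounds the powers of [P] without giving
    [|P| <= 1] in the norm used, so the Gronwall argument runs on a majorant of the errors, not on
    their norms. *)

Section MatrixNorm.
Context {K : realType}.

Lemma mx_norm_entry p q (A : 'M[K]_(p, q)) i j : `|A i j| <= `|A|.
Proof.
by rewrite [leRHS]/Num.Def.normr/= mx_normrE; exact: (le_bigmax _ _ (i, j)).
Qed.

Lemma mx_norm_le p q (A : 'M[K]_(p, q)) x :
  0 <= x -> (forall i j, `|A i j| <= x) -> `|A| <= x.
Proof.
move=> x0 Ax; rewrite [leLHS]/Num.Def.normr/= mx_normrE.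
by rewrite bigmax_le// => -[i j] _; exact: Ax.
Qed.

Lemma mulmx_norm_le p q r (A : 'M[K]_(p, q)) (B : 'M[K]_(q, r)) :
  `|A *m B| <= q%:R * `|A| * `|B|.
Proof.
apply: mx_norm_le => [|i j]; first by rewrite !mulr_ge0.
rewrite mxE (le_trans (ler_norm_sum _ _ _))//.
rewrite -mulrA -[q in q%:R]card_ord -sumr_const mulr_suml ler_sum// => l _.
by rewrite mul1r normrM ler_pM// mx_norm_entry.
Qed.

End MatrixNorm.

(** * Smooth functions of one variable *)

Section ScalarTaylor.
Context {K : realType}.
Implicit Types (f df : K -> K) (phi : nat -> K -> K).

(** The end points are unordered because Taylor increments [c_i h] and [(c_i - 1) h / sigma] may
    have either sign. *)
Lemma mean_value_le f df (t z B : K) :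
  (forall y, Num.min t z <= y <= Num.max t z ->
     is_derive y 1 f (df y) /\ `|df y| <= B) ->
  `|f z - f t| <= B * `|z - t|.
Proof.
wlog tz : t z / t <= z => [hw|] H.
  have [tz|zt] := leP t z; first exact: hw.
  rewrite distrC [`|z - t|]distrC; apply: hw (ltW zt) _ => y yzt.
  by apply: H; rewrite minC maxC.
have H' y : t <= y <= z -> is_derive y 1 f (df y) /\ `|df y| <= B.
  by move=> ?; apply: H; rewrite (min_idPl tz) (max_idPr tz).
have [||x xtz ->] := @MVT_segment _ f df t z tz.
- by move=> x /[!in_itv]/= /andP[tx xz]; apply: (H' x _).1; rewrite !ltW.
- apply: derivable_within_continuous => x /[!in_itv]/= txz.
  exact: (@ex_derive _ _ _ _ _ _ _ (H' x txz).1).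
- rewrite normrM ler_wpM2r//; apply: (H' x _).2.
  by move: xtz; rewrite in_itv.
Qed.

(** With the derivatives listed as a sequence, the chain of [u'] is a shift of the chain of [u], so
    their Taylor polynomials share coefficients. *)
Definition deriv_chain (a b : K) k phi :=
  (forall j, (j < k)%N -> forall t, a < t < b ->
     is_derive t 1 (phi j) (phi j.+1 t)) /\
  (forall t, a < t < b -> {for t, continuous (phi k)}).

Lemma deriv_chain_shift a b k phi : deriv_chain a b k.+1 phi ->
  deriv_chain a b k (fun j => phi j.+1).
Proof. by case=> H1 H2; split=> // j jk t; exact: H1. Qed.

Lemma deriv_chain_trunc a b k k' phi : (k' <= k)%N -> deriv_chain a b k phi ->
  deriv_chain a b k' phi.
Proof.
rewrite leq_eqVlt => /predU1P[->//|k'k] [H1 H2]; split=> [j jk'|t tab].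
  exact/H1/(ltn_trans jk').
apply/differentiable_continuous/derivable1_diffP.
exact: (@ex_derive _ _ _ _ _ _ _ (H1 _ k'k _ tab)).
Qed.

Lemma deriv_chain_shiftn a b j k phi : deriv_chain a b (j + k) phi ->
  deriv_chain a b k (fun i => phi (j + i)%N).
Proof.
elim: j k phi => [//|j IH] k phi; rewrite addSn => /deriv_chain_shift /IH.
by under [X in _ -> deriv_chain _ _ _ X]eq_fun do rewrite addSn.
Qed.

Lemma continuous_bounded_itv (a b a' b' : K) f : a < a' -> b' < b ->
  (forall t, a < t < b -> {for t, continuous f}) ->
  exists2 M : K, 0 <= M & forall t, a' <= t <= b' -> `|f t| <= M.
Proof.
move=> aa' bb' cf; have [ab|ba] := leP a' b'; last first.
  exists 0 => // t /andP[h1 h2].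
  by have := lt_le_trans ba (le_trans h1 h2); rewrite ltxx.
have cf' : {within `[a', b'], continuous (fun t => `|f t|)}.
  apply/continuous_in_subspaceT => t /[!inE]/=; rewrite in_itv/= => /andP[h1 h2].
  apply: continuous_comp; last exact: norm_continuous.
  by apply: cf; rewrite (lt_le_trans aa' h1) (le_lt_trans h2).
have [c cab H] := EVT_max ab cf'.
by exists `|f c| => // t tab; apply: H; rewrite in_itv.
Qed.

(** The remainder of order [k + 1] vanishes at the centre, and its derivative is the remainder of
    order [k] of the shifted chain; the mean value theorem then gains one factor [|x|]. The constant
    stays the bound of the top derivative on the compact interval. *)
Lemma deriv_chain_taylor (a b a' b' : K) k phi : a < a' -> b' < b ->
  deriv_chain a b k phi ->
  exists2 M : K, 0 <= M & forall t x, a' <= t <= b' -> a' <= t + x <= b' ->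
    `|phi 0%N (t + x) - \sum_(j < k) x ^+ j / j`!%:R * phi j t| <= M * `|x| ^+ k.
Proof.
move=> aa' bb'; elim: k phi => [|k IH] phi ch.
  have [M M0 HM] := continuous_bounded_itv aa' bb' ch.2.
  by exists M => // t x tab txab; rewrite big_ord0 subr0 expr0 mulr1 HM.
have [M M0 HM] := IH _ (deriv_chain_shift ch).
exists M => // t x tab txab.
pose G z := phi 0%N z - \sum_(j < k.+1) (z - t) ^+ j / j`!%:R * phi j t.
pose dG z := phi 1%N z - \sum_(j < k) (z - t) ^+ j / j`!%:R * phi j.+1 t.
have Gt : G t = 0.
  rewrite /G big_ord_recl /= fact0 expr0 divr1 mul1r big1 ?addr0 ?subrr//.
  by move=> i _; rewrite ?subrr expr0n /= !mul0r.
have -> : phi 0%N (t + x) - \sum_(j < k.+1) x ^+ j / j`!%:R * phi j t =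
          G (t + x) - G t.
  by rewrite Gt subr0 /G [t + x - t]addrC addKr.
have := @mean_value_le G dG t (t + x) (M * `|x| ^+ k).
rewrite [t + x - t]addrC addKr exprSr mulrA; apply => y yb.
have [yab ytx] : a' <= y <= b' /\ `|y - t| <= `|x|.
  move: yb tab txab; rewrite /Num.min /Num.max; case: ltP => h.
    move=> /andP[h1 h2] /andP[h3 h4] /andP[h5 h6].
    have -> : `|x| = x by rewrite ger0_norm//; lra.
    have -> : `|y - t| = y - t by rewrite ger0_norm//; lra.
    by split; [apply/andP; split|]; lra.
  move=> /andP[h1 h2] /andP[h3 h4] /andP[h5 h6].
  have -> : `|x| = - x by rewrite ler0_norm//; lra.
  have -> : `|y - t| = - (y - t) by rewrite ler0_norm//; lra.
  by split; [apply/andP; split|]; lra.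
split.
  have yab' : a < y < b by move/andP: yab => [h1 h2]; apply/andP; split; lra.
  rewrite /G /dG.
  have -> : (fun z => phi 0%N z - \sum_(j < k.+1) (z - t) ^+ j / j`!%:R * phi j t)
    = phi 0%N - \sum_(j < k.+1) (fun z => (j`!%:R^-1 * phi j t) *: (z - t) ^+ j).
    apply/funext => z; rewrite !fctE fct_sumE; congr (_ - _).
    by apply: eq_bigr => j _; rewrite -mulrA mulrC.
  apply: is_deriveB; first exact: ch.1.
  have -> : \sum_(j < k) (y - t) ^+ j / j`!%:R * phi j.+1 t =
     \sum_(j < k.+1) (j`!%:R^-1 * phi j t) *: (j%:R * (y - t) ^+ j.-1).
    rewrite [RHS]big_ord_recl mul0r scaler0 add0r; apply: eq_bigr => j _.
    rewrite lift0 /= factS natrM /GRing.scale/=.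
    by field; rewrite nat1r !pnatr_eq0 -lt0n fact_gt0.
  have /= := @is_derive_sum K K K k.+1
    (fun j z => (j`!%:R^-1 * phi j t) *: (z - t) ^+ j) y 1
    (fun j => (j`!%:R^-1 * phi j t) *: (j%:R * (y - t) ^+ j.-1)).
  apply=> j; apply: is_deriveZ.
  have H : is_derive y 1 (fun z : K => z - t) 1.
    by apply: is_derive_eq; rewrite subr0.
  have -> : (fun z => (z - t) ^+ j) = (fun z : K => z - t) ^+ j.
    by apply/funext => z; rewrite fctE.
  by apply: is_derive_eq; rewrite /GRing.scale/= mulr1 mulr_natl.
have := HM t (y - t) tab; rewrite addrC subrK => /(_ yab) /le_trans; apply.
by rewrite ler_wpM2l// lerXn2r ?nnegrE.
Qed.

End ScalarTaylor.

Section Smooth.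
Context {K : realType} (a b : K).
Implicit Types (f g df : K -> K).

(* The derivatives are only constrained on ]a, b[, hence are existentially
   quantified rather than computed by ['D_1]. *)
Fixpoint smooth k f : Prop :=
  match k with
  | 0%N => forall t, a < t < b -> {for t, continuous f}
  | k'.+1 => exists df,
      (forall t, a < t < b -> is_derive t 1 f (df t)) /\ smooth k' df
  end.

Lemma smooth_deriv_chain k f : smooth k f ->
  exists2 phi : nat -> K -> K, phi 0%N = f & deriv_chain a b k phi.
Proof.
elim: k f => [|k IH] f /=.
  by move=> cf; exists (fun=> f).
move=> [df [fdf /IH[phi phi0 [H1 H2]]]].
exists (fun j => if j is i.+1 then phi i else f) => //.
by split=> // -[|j] jk t tab; [rewrite phi0; exact: fdf|exact: H1].
Qed.

Lemma is_derive_continuous f (t l : K) : is_derive t 1 f l -> {for t, continuous f}.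
Proof.
move=> H; apply/differentiable_continuous/derivable1_diffP.
exact: (@ex_derive _ _ _ _ _ _ _ H).
Qed.

Lemma smoothW k f : smooth k.+1 f -> smooth k f.
Proof.
elim: k f => [|k IH] f [df [fdf sdf]].
  by move=> t tab; exact: is_derive_continuous (fdf t tab).
by exists df; split=> //; exact: IH.
Qed.

Lemma smoothD k f g : smooth k f -> smooth k g -> smooth k (fun t => f t + g t).
Proof.
elim: k f g => [|k IH] f g /=.
  by move=> cf cg t tab; apply: continuousD; [exact: cf|exact: cg].
move=> [df [fdf sdf]] [dg [gdg sdg]].
exists (fun t => df t + dg t); split; last exact: IH.
by move=> t tab; apply: is_deriveD; [exact: fdf|exact: gdg].
Qed.

Lemma smoothM k f g : smooth k f -> smooth k g -> smooth k (fun t => f t * g t).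
Proof.
elim: k f g => [|k IH] f g.
  by move=> cf cg t tab; apply: continuousM; [exact: cf|exact: cg].
move=> sf sg; have [sf' sg'] := (smoothW sf, smoothW sg).
case: sf sg => [df [fdf sdf]] [dg [gdg sdg]].
exists (fun t => f t * dg t + g t * df t); split; last first.
  by apply: smoothD; exact: IH.
by move=> t tab; apply: is_deriveM; [exact: fdf|exact: gdg].
Qed.

Lemma smooth0 k : smooth k (fun=> 0).
Proof.
elim: k => [|k IH] /=; first by move=> t _; exact: cst_continuous.
by exists (fun=> 0); split=> // t _; exact: is_derive_cst.
Qed.

Lemma smooth_sum k (I : Type) (r : seq I) (F : I -> K -> K) :
  (forall i, smooth k (F i)) -> smooth k (fun t => \sum_(i <- r) F i t).
Proof.
move=> sF; elim: r => [|i r IH].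
  by under eq_fun do rewrite big_nil; exact: smooth0.
by under eq_fun do rewrite big_cons; exact: smoothD.
Qed.

End Smooth.

Section ContDiff.
Context {K : realType} (a b : K).

Lemma cont_diffW (V W : normedModType K) k U (f : V -> W) :
  cont_diff k.+1 U f -> cont_diff k U f.
Proof.
elim: k f => [|k IH] f [df cdf].
  by move=> x Ux; exact/differentiable_continuous/df.
by split=> // v; exact: IH.
Qed.

Lemma cont_diff_smooth m k (u : K -> 'rV[K]_m) j :
  cont_diff k [set t : K | a < t < b] u -> smooth a b k (fun t => u t 0 j).
Proof.
elim: k u => [|k IH] u /=.
  move=> cu t tab.
  apply: (@continuous_comp _ _ _ u (fun M : 'rV[K]_m => M 0 j)); first exact: cu.
  exact: coord_continuous.
move=> [du cdu]; exists (fun t => ('D_1 u t) 0 j); split; last exact: IH.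
move=> t tab; have dut : derivable u t 1 by apply: diff_derivable; exact: du.
rewrite derive_mx// mxE; apply: derivableP.
by move/derivable_mxP : dut; exact.
Qed.

(** By the chain rule the derivative is a sum of products of components of [u'] with partial
    derivatives of [F] composed with [u]. These compositions have the original shape, so the
    induction has to vary [F]. *)
Lemma cont_diff_comp_smooth m p k (F : 'rV[K]_m -> 'rV[K]_p) (u : K -> 'rV[K]_m) j :
  cont_diff k setT F -> cont_diff k [set t : K | a < t < b] u ->
  smooth a b k (fun t => F (u t) 0 j).
Proof.
elim: k F u => [|k IH] F u.
  move=> cF cu t tab.
  apply: (@continuous_comp _ _ _ u (fun x => F x 0 j)); first exact: cu.
  apply: (@continuous_comp _ _ _ F (fun M : 'rV[K]_p => M 0 j)); first exact: cF.
  exact: coord_continuous.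
move=> cF cu; have cu' := cont_diffW cu; case: cF cu => dF cdF [du cdu].
exists (fun t => \sum_i ('D_1 u t) 0 i * ('D_(delta_mx 0 i) F (u t)) 0 j).
split; last first.
  apply: smooth_sum => i; apply: smoothM; last first.
    exact: (IH (fun x => 'D_(delta_mx 0 i) F x) u (cdF _) cu').
  exact: (@cont_diff_smooth m k (fun x => 'D_1 u x) i (cdu 1)).
move=> t tab; have dut := du t tab; have dFt := dF (u t) I.
have dFu : differentiable (F \o u) t by exact: differentiable_comp.
have dFu1 : derivable (F \o u) t 1 by exact: diff_derivable.
have -> : \sum_i ('D_1 u t) 0 i * ('D_(delta_mx 0 i) F (u t)) 0 j =
          ('D_1 (F \o u) t) 0 j.
  have -> : 'D_1 (F \o u) t = 'd F (u t) ('D_1 u t).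
    by rewrite [LHS]deriveE// diff_comp//= [in RHS]deriveE.
  rewrite [in RHS](row_sum_delta ('D_1 u t)) linear_sum summxE.
  by apply: eq_bigr => i _; rewrite linearZ mxE (deriveE _ dFt).
rewrite derive_mx// mxE; apply: derivableP.
by move/derivable_mxP : dFu1; exact.
Qed.

End ContDiff.

(** * Order conditions *)

Section Fredholm.
Context {F : fieldType}.

(** The columns of the cokernel matrix of [A^T] lie in the kernel of [A^T], so testing against them
    alone decides membership in the range. It turns the order conditions into solvability with
    matrix [I - P]. *)
Lemma fredholm_alternative s (A : 'M[F]_s) (x : 'cV[F]_s) :
  (forall v : 'cV[F]_s, A^T *m v = 0 -> v^T *m x = 0) -> exists y, x = A *m y.
Proof.
move=> H; have /submxP[y xy] : (x^T <= A^T)%MS; last first.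
  by exists y^T; rewrite -[x]trmxK xy trmx_mul trmxK.
rewrite submxE; apply/eqP/row_matrixP => i; apply/rowP => j.
rewrite ord1 {i} !mxE.
have : A^T *m col j (cokermx A^T) = 0 by rewrite colE mulmxA mulmx_coker mul0mx.
move/H/(congr1 (fun M : 'M[F]_1 => M 0 0)); rewrite !mxE => Hj.
by rewrite -[RHS]Hj; apply: eq_bigr => k _; rewrite !mxE mulrC.
Qed.

End Fredholm.

(** * Taylor residuals of the implicit scheme and of the extrapolation *)

Section PeerAlgebra.
Context {K : realType} {s : nat}.
Implicit Types (c z : 'cV[K]_s) (P Q R E : 'M[K]_s).

Lemma Dmx_unit : Dmx K s \in unitmx.
Proof.
rewrite unitmxE det_diag unitfE; apply/prodf_neq0 => i _.
by rewrite mxE pnatr_eq0.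
Qed.

Lemma V1_unit c : (forall i j, i != j -> c i 0 != c j 0) -> V1 c \in unitmx.
Proof.
move=> cdist; have -> : V1 c = (Vandermonde s (c^T - const_mx 1))^T.
  by apply/matrixP => i j; rewrite !mxE.
rewrite unitmx_tr unitmxE det_Vandermonde unitfE.
apply/prodf_neq0 => i _; apply/prodf_neq0 => j ij; rewrite !mxE.
rewrite opprB addrA subrK subr_eq0; apply: cdist.
by apply/eqP => ji; move: ij; rewrite ji ltnn.
Qed.

Lemma V0_col c (j : 'I_s) : V0 c *m delta_mx j 0 = cpow c j.
Proof. by rewrite -colE; apply/colP => i; rewrite !mxE. Qed.

Lemma V1_col c (j : 'I_s) : V1 c *m delta_mx j 0 = cpow (c - ones K s) j.
Proof. by rewrite -colE; apply/colP => i; rewrite !mxE. Qed.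

Lemma Smx_col (sigma : K) (j : 'I_s) :
  Smx s sigma *m delta_mx j 0 = sigma ^+ j *: (delta_mx j 0 : 'cV_s).
Proof.
rewrite mul_diag_mx; apply/colP => i; rewrite !mxE eqxx andbT.
by case: eqP => [->//|]; rewrite !mulr0.
Qed.

Lemma Cmx_mul_V0 c : Cmx c *m V0 c = \matrix_(i, j) c i 0 ^+ j.+1.
Proof. by rewrite mul_diag_mx; apply/matrixP => i j; rewrite !mxE exprS. Qed.

(** [V1^-1] sends a column of shifted powers to a unit vector. Hence [E1] extrapolates exactly every
    polynomial of degree below [s]. *)
Lemma extrapE1_cpow c E (sigma : K) (j : nat) :
  (forall i j, i != j -> c i 0 != c j 0) -> (j < s)%N ->
  extrapE1 c E sigma *m cpow (c - ones K s) j =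
    sigma ^+ j *: ((1%:M - E) *m cpow c j).
Proof.
move=> cdist js; rewrite -(V1_col c (Ordinal js)) /extrapE1 -!mulmxA.
by rewrite mulKmx ?V1_unit// Smx_col -!scalemxAr V0_col.
Qed.

(** [Y j] stands for the [j]-th derivative at the centre; the column [cpow z j] times the row [Y j]
    is the matrix form of a Kronecker product. *)
Definition stage_taylor (z : 'cV[K]_s) m (h : K) k (Y : nat -> 'rV[K]_m) :=
  \sum_(j < k) (h ^+ j / j`!%:R) *: (cpow z j *m Y j).

(** An exact identity: the constant terms cancel by [P e = e], and a derivative term of degree [j],
    multiplied by [h], joins the term of degree [j + 1] of the function, which explains the lengths
    [k + 1] and [k]. *)
Lemma peer_taylor_residual m c P Q R sigma h (Y : nat -> 'rV[K]_m) k :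
  sigma != 0 -> P *m ones K s = ones K s ->
  stage_taylor c h k.+1 Y
    - P *m stage_taylor (c - ones K s) (h / sigma) k.+1 Y
    - h *: (Q *m stage_taylor (c - ones K s) (h / sigma) k (fun j => Y j.+1)
            + R *m stage_taylor c h k (fun j => Y j.+1)) =
  \sum_(j < k) h ^+ j.+1 *: (defect c P Q R sigma j.+1 *m Y j.+1).
Proof.
move=> s0 Pe; rewrite /stage_taylor !mulmx_sumr -big_split/= scaler_sumr.
rewrite -!sumrB big_ord_recl !expr0 fact0 divr1 !scale1r.
have -> z : cpow z 0 = ones K s by apply/colP => i; rewrite !mxE expr0.
rewrite mulmxA Pe subrr add0r -sumrB; apply: eq_bigr => j _.
rewrite /defect factS natrM /= -!scalemxAr.
rewrite !mulmxA -[in RHS]scalemxAl. rewrite 3!mulmxBl. rewrite -!scalemxAl.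
have f0 : (j`!%:R : K) != 0 by rewrite pnatr_eq0 -lt0n fact_gt0.
have j0 : (j.+1%:R : K) != 0 by rewrite pnatr_eq0.
move: (cpow c j.+1 *m _) (P *m _ *m _) (Q *m _ *m _) (R *m _ *m _) => A B C D.
rewrite !scalerBr scalerDr opprD !addrA !scalerA.
have sj0 : sigma ^+ j != 0 by rewrite expf_neq0.
rewrite [bump 0 j]add1n !exprS !expr_div_n.
move: (j.+1%:R) (j`!%:R) (sigma ^+ j) (h ^+ j) f0 j0 sj0 => x y p q f0 j0 p0.
have -> : h / sigma * (q / p) / (x * y) = h * q / (x * y) / (sigma * p).
  by field; rewrite f0 j0 p0 s0.
have -> : h * (q / p / y) = h * q / (x * y) * (x / p).
  by field; rewrite f0 j0 p0.
by have -> : h * (q / y) = h * q / (x * y) * x by field; rewrite f0 j0.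
Qed.

(** The counterpart of [defect] for the extrapolation: the coefficient at degree [s], the first one
    beyond its exactness. *)
Definition extrap_defect c E sigma : 'cV[K]_s :=
  (s`!%:R)^-1 *: ((1%:M - E) *m cpow c s
    - sigma ^- s *: (extrapE1 c E sigma *m cpow (c - ones K s) s)).

Lemma extrap_taylor_residual m c E sigma h (Y : nat -> 'rV[K]_m) :
  (forall i j, i != j -> c i 0 != c j 0) -> sigma != 0 ->
  (1%:M - E) *m stage_taylor c h s.+1 Y
    - extrapE1 c E sigma *m stage_taylor (c - ones K s) (h / sigma) s.+1 Y =
  h ^+ s *: (extrap_defect c E sigma *m Y s).
Proof.
move=> cdist s0; rewrite /stage_taylor !mulmx_sumr -sumrB big_ord_recr/=.
rewrite big1 ?add0r => [|j _]; last first.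
  rewrite -!scalemxAr !mulmxA extrapE1_cpow//= -scalemxAl scalerA.
  rewrite -scalerBl expr_div_n; set x := (X in X *: _).
  suff -> : x = 0 by rewrite scale0r.
  by rewrite /x mulrAC mulfVK ?subrr// expf_neq0.
rewrite /extrap_defect -!scalemxAr !mulmxA -scalemxAl [in RHS]mulmxBl.
by rewrite -!scalemxAl !scalerBr !scalerA expr_div_n mulrAC.
Qed.

End PeerAlgebra.

(** * Orthogonality of the leading coefficients at ratio 1 *)

Section OrderConditions.
Context {K : realType} {s : nat} (hs : (0 < s)%N).
Context (c : 'cV[K]_s) (P R E : 'M[K]_s).
Hypothesis c_distinct : forall i j : 'I_s, i != j -> c i 0 != c j 0.
Hypothesis c_last : forall i : 'I_s, i.+1 = s -> c i 0 = 1.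

(* As 0 = c_s - 1 is a node, the interpolation polynomial of x^s at the nodes
   c_i - 1 has no constant term. *)
Lemma interp_pow_coef0 (x : 'cV[K]_s) (i : 'I_s) : i = 0%N :> nat ->
  V1 c *m x = cpow (c - ones K s) s -> x i 0 = 0.
Proof.
move=> i0; have ls : (s.-1 < s)%N by rewrite prednK.
move/(congr1 (fun M : 'cV[K]_s => M (Ordinal ls) 0)); rewrite !mxE.
rewrite (bigD1 i)//= big1 ?addr0 => [|j ji]; rewrite !mxE c_last /= ?prednK//.
  by rewrite subrr i0 expr0 mul1r expr0n gtn_eqF.
rewrite subrr expr0n; have -> : (j == 0%N :> nat) = false; last by rewrite mul0r.
by apply/negbTE; move: ji; rewrite -i0.
Qed.

Variable v : 'cV[K]_s.

(** Column [i] of [W] is [c^(i+1) - (i+1) R c^i], so [v^T W] can be nonzero only in column 0, where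
    [y] vanishes. Thus [v^T Q (c-e)^s] reduces to [- v^T (C-I) V1 y]. This cancels the term of [P],
    which is [v^T (c-e)^(s+1)] because [v^T P = v^T]; the rest is the condition at [j = s + 1]. *)
Lemma defect1_orthogonal :
  v^T *m P = v^T ->
  v^T *m ((Cmx c - 1%:M) *m V1 c *m Dtilde K s *m invmx (V1 c)
             *m cpow (c - ones K s) s) = 0 ->
  (forall j : nat, (2 <= j <= s.+1)%N ->
     v^T *m (cpow c j - j%:R *: (R *m cpow c j.-1)) = 0) ->
  v^T *m defect c P (peerQ c P R 1) R 1 s.+1 = 0.
Proof.
move=> vP vV vR.
have uV := V1_unit c_distinct; have uD := @Dmx_unit K s.
pose y := invmx (V1 c *m Dmx K s) *m cpow (c - ones K s) s.
have Vy : V1 c *m (Dmx K s *m y) = cpow (c - ones K s) s.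
  by rewrite mulmxA /y mulKVmx// unitmx_mul uV.
have y0 (i : 'I_s) : i = 0%N :> nat -> y i 0 = 0.
  move=> i0; have := interp_pow_coef0 i0 Vy.
  by rewrite mul_diag_mx !mxE i0 mul1r.
pose W := Cmx c *m V0 c - R *m V0 c *m Dmx K s.
have vW (i : 'I_s) : (0 < i)%N -> (v^T *m W) 0 i = 0.
  move=> i0; have := vR i.+1; rewrite !ltnS i0 ltnW//= => /(_ isT).
  move/(congr1 (fun M : 'M[K]_1 => M 0 0)); rewrite [in RHS]mxE => <-.
  rewrite !mxE; apply: eq_bigr => l _; congr (_ * _).
  rewrite /W Cmx_mul_V0 mul_mx_diag !mxE [in RHS]mulrC; congr (_ - _ * _).
  by apply: eq_bigr => l' _; rewrite !mxE.
have vWy : v^T *m W *m y = 0.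
  apply/matrixP => i j; rewrite !ord1 [LHS]mxE [RHS]mxE.
  apply: big1 => l _; have [l0|l0] := posnP l; first by rewrite y0 ?mulr0.
  by rewrite vW ?mul0r.
have vQ : v^T *m (peerQ c P R 1 *m cpow (c - ones K s) s) =
          - (v^T *m ((Cmx c - 1%:M) *m V1 c *m y)).
  rewrite /peerQ -[X in _ *m X = _]mulmxA -/y invr1 scale1r -/W.
  have -> : Smx s 1 = 1%:M :> 'M[K]_s.
    by apply/matrixP => i j; rewrite !mxE expr1n.
  by rewrite mulmx1 mulmxBl mulmxBr mulmxA vWy sub0r -!mulmxA mulmxA vP.
(* As [Dtilde = (s+1) D^-1 - I], the condition on [(C-I) V1 Dtilde V1^-1 (c-e)^s] is the difference
   of the two sides here. *)
have vC : s.+1%:R *: (v^T *m ((Cmx c - 1%:M) *m V1 c *m y)) =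
          v^T *m cpow (c - ones K s) s.+1.
  apply/eqP; rewrite -subr_eq0 -vV; apply/eqP.
  have Dy : Dtilde K s *m (Dmx K s *m y) = s.+1%:R *: y - Dmx K s *m y.
    by rewrite /Dtilde mulmxBl mul1mx -scalemxAl mulKmx.
  rewrite -[in RHS]Vy -!mulmxA mulKmx// Dy !mulmxBr -!scalemxAr Vy.
  congr (_ - v^T *m _).
  by apply/colP => i; rewrite mulmxBl mul1mx mul_diag_mx !mxE exprS mulrBl mul1r.
have vR' := vR s.+1; rewrite !ltnS hs leqnn /= in vR'.
rewrite /defect !expr1n invr1 scale1r mulr1 /= -scalemxAr.
set A := cpow c s.+1; set B := P *m _; set C := _ *: (peerQ c P R 1 *m _).
have -> : A - B - C - s.+1%:R *: (R *m cpow c s) =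
          A - s.+1%:R *: (R *m cpow c s) - B - C.
  by rewrite addrAC; congr (_ + _); rewrite addrAC.
rewrite 2!mulmxBr (vR' isT) /C -scalemxAr vQ scalerN opprK vC mulmxA vP.
by rewrite sub0r addNr scaler0.
Qed.

(** Same mechanism: [v^T R (I-E) V0] vanishes outside column 0, where the interpolation coefficients
    [x] vanish, and [v^T R (I-E) c^s] is killed by the condition at [j = s + 1]. *)
Lemma extrap_defect1_orthogonal :
  (forall j : nat, (2 <= j <= s.+1)%N ->
     v^T *m (R *m (E - 1%:M) *m cpow c j.-1) = 0) ->
  v^T *m (R *m extrap_defect c E 1) = 0.
Proof.
move=> vE; have uV := V1_unit c_distinct.
pose x := invmx (V1 c) *m cpow (c - ones K s) s.
have Vx : V1 c *m x = cpow (c - ones K s) s by rewrite mulKVmx.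
have {}vE j : (0 < j <= s)%N -> v^T *m (R *m (1%:M - E)) *m cpow c j = 0.
  move=> /andP[j0 js]; have := vE j.+1; rewrite !ltnS j0 js => /(_ isT) /=.
  by rewrite -opprB !(mulmxN, mulNmx) !mulmxA => /eqP; rewrite oppr_eq0 => /eqP.
rewrite /extrap_defect expr1n invr1 scale1r /extrapE1 -!scalemxAr.
have -> : Smx s 1 = 1%:M :> 'M[K]_s by apply/matrixP => i j; rewrite !mxE expr1n.
have -> : (1%:M - E) *m V0 c *m 1%:M *m invmx (V1 c) *m cpow (c - ones K s) s =
          (1%:M - E) *m (V0 c *m x) by rewrite mulmx1 -!mulmxA.
rewrite -mulmxBr [R *m _]mulmxA mulmxA mulmxBr vE ?hs ?leqnn// sub0r mulmxA.
suff -> : v^T *m (R *m (1%:M - E)) *m V0 c *m x = 0 by rewrite oppr0 scaler0.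
apply/matrixP => i j; rewrite !ord1 [LHS]mxE [RHS]mxE; apply: big1 => l _.
have [l0|l0] := posnP l; first by rewrite (interp_pow_coef0 l0 Vx) mulr0.
have := vE l; rewrite l0 ltnW//= => /(_ isT).
move/(congr1 (fun M : 'M[K]_1 => M 0 0)); rewrite [RHS]mxE => H.
suff -> : (v^T *m (R *m (1%:M - E)) *m V0 c) 0 l = 0 by rewrite mul0r.
by rewrite -[RHS]H [LHS]mxE [RHS]mxE; apply: eq_bigr => k _; rewrite !mxE.
Qed.

End OrderConditions.

(** * Dependence on the step size ratio *)

Section LipschitzAtOne.
Context {K : realType}.

(** Only the deviation from the value at 1 matters, since the order conditions are used at ratio 1.
    The window [[1/2, 2]] keeps the negative powers of the ratio bounded. *)
Definition lip1 (V : normedModType K) (f : K -> V) := exists2 M : K, 0 <= M &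
  forall x, 2^-1 <= x <= 2 -> `|f x - f 1| <= M * `|x - 1|.

Lemma lip1_bounded (V : normedModType K) (f : K -> V) : lip1 f ->
  exists2 B : K, 0 <= B & forall x, 2^-1 <= x <= 2 -> `|f x| <= B.
Proof.
move=> [M M0 HM]; exists (M + `|f 1|); first by rewrite addr_ge0.
move=> x x2; rewrite -[f x](subrK (f 1)) (le_trans (ler_normD _ _))// lerD2r.
rewrite (le_trans (HM x x2))// ler_piMr// ler_norml.
by move/andP: x2 => [x1 x2]; apply/andP; split; lra.
Qed.

Lemma lip1_cst (V : normedModType K) (v : V) : lip1 (fun=> v).
Proof. by exists 0 => // x _; rewrite subrr normr0 mul0r. Qed.

Lemma lip1D (V : normedModType K) (f g : K -> V) :
  lip1 f -> lip1 g -> lip1 (fun x => f x + g x).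
Proof.
move=> [M M0 HM] [N N0 HN]; exists (M + N); first by rewrite addr_ge0.
move=> x x2; rewrite opprD addrACA (le_trans (ler_normD _ _))// mulrDl.
by rewrite lerD ?HM ?HN.
Qed.

Lemma lip1N (V : normedModType K) (f : K -> V) : lip1 f -> lip1 (fun x => - f x).
Proof. by move=> [M M0 HM]; exists M => // x x2; rewrite -opprD normrN HM. Qed.

Lemma lip1B (V : normedModType K) (f g : K -> V) :
  lip1 f -> lip1 g -> lip1 (fun x => f x - g x).
Proof. by move=> lf lg; apply: lip1D; last exact: lip1N. Qed.

Lemma lip1Z (V : normedModType K) (f : K -> K) (g : K -> V) :
  lip1 f -> lip1 g -> lip1 (fun x => f x *: g x).
Proof.
move=> lf [N N0 HN]; have [B B0 HB] := lip1_bounded lf; case: lf => [M M0 HM].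
exists (B * N + M * `|g 1|); first by rewrite addr_ge0 ?mulr_ge0.
move=> x x2; have -> : f x *: g x - f 1 *: g 1 =
    f x *: (g x - g 1) + (f x - f 1) *: g 1.
  by rewrite scalerBr scalerBl addrA subrK.
rewrite (le_trans (ler_normD _ _))// !normrZ mulrDl lerD//.
  by rewrite -mulrA ler_pM ?HB ?HN.
by rewrite mulrAC ler_wpM2r ?HM.
Qed.

Lemma lip1_mulmx p q r (f : K -> 'M[K]_(p, q)) (g : K -> 'M[K]_(q, r)) :
  lip1 f -> lip1 g -> lip1 (fun x => f x *m g x).
Proof.
move=> lf [N N0 HN]; have [B B0 HB] := lip1_bounded lf; case: lf => [M M0 HM].
exists (q%:R * (B * N) + q%:R * (M * `|g 1|)); first by rewrite !(addr_ge0, mulr_ge0).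
move=> x x2; have -> : f x *m g x - f 1 *m g 1 =
    f x *m (g x - g 1) + (f x - f 1) *m g 1.
  by rewrite mulmxBr mulmxBl addrA subrK.
rewrite (le_trans (ler_normD _ _))// mulrDl.
rewrite lerD// (le_trans (mulmx_norm_le _ _))// -!mulrA ler_wpM2l//.
  by rewrite ler_pM ?HB ?HN.
by rewrite [`|g 1| * _]mulrC mulrA ler_wpM2r ?HM.
Qed.

Lemma lip1X n : lip1 (fun x : K => x ^+ n).
Proof.
elim: n => [|n IH]; first by under eq_fun do rewrite expr0; exact: lip1_cst.
under eq_fun do rewrite exprS; apply: (@lip1Z K id) => //.
by exists 1 => // x _; rewrite mul1r.
Qed.

Lemma lip1V : lip1 (fun x : K => x^-1).
Proof.
exists 2 => // x /andP[x1 x2]; have x0 : 0 < x by lra.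
have -> : x^-1 - 1^-1 = x^-1 * (1 - x).
  by rewrite mulrBr mulr1 mulVf ?gt_eqF// invr1.
rewrite normrM distrC ler_wpM2r// ger0_norm ?invr_ge0 ?(ltW x0)//.
by rewrite -[leRHS]invrK lef_pV2 ?posrE ?invr_gt0.
Qed.

Lemma lip1XV n : lip1 (fun x : K => (x ^+ n)^-1).
Proof.
elim: n => [|n IH]; first by under eq_fun do rewrite expr0; exact: lip1_cst.
by under eq_fun do rewrite exprS invfM; exact: (@lip1Z K _ _ lip1V).
Qed.

Lemma lip1_sum (V : normedModType K) (I : Type) (r : seq I) (f : I -> K -> V) :
  (forall i, lip1 (f i)) -> lip1 (fun x => \sum_(i <- r) f i x).
Proof.
move=> lf; elim: r => [|i r IH].
  by under eq_fun do rewrite big_nil; exact: lip1_cst.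
by under eq_fun do rewrite big_cons; exact: lip1D.
Qed.

Lemma lip1_Smx s : lip1 (Smx s : K -> 'M[K]_s).
Proof.
have -> : (Smx s : K -> 'M[K]_s) =
    (fun x => \sum_(j < s) x ^+ j *: delta_mx j j).
  apply/funext => x; apply/matrixP => i j; rewrite summxE (bigD1 i)//= big1.
    by rewrite !mxE eqxx addr0 mulr_natr eq_sym; case: eqP => // ->.
  by move=> k ki; rewrite !mxE eq_sym (negbTE ki) mulr0.
by apply: lip1_sum => j; apply: lip1Z; [exact: lip1X|exact: lip1_cst].
Qed.

Lemma lip1_peerQ s (c : 'cV[K]_s) P R : lip1 (peerQ c P R).
Proof.
apply: lip1_mulmx; last exact: lip1_cst.
apply: lip1B; first by apply: lip1_mulmx; [exact: lip1_cst|exact: lip1_Smx].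
by apply: lip1Z; [exact: lip1V|exact: lip1_cst].
Qed.

Lemma lip1_extrapE1 s (c : 'cV[K]_s) E : lip1 (extrapE1 c E).
Proof.
apply: lip1_mulmx; last exact: lip1_cst.
by apply: lip1_mulmx; [exact: lip1_cst|exact: lip1_Smx].
Qed.

Lemma lip1_Qhat s (c : 'cV[K]_s) P R E : lip1 (Qhat c P R E).
Proof.
apply: lip1D; first exact: lip1_peerQ.
by apply: lip1_mulmx; [exact: lip1_cst|exact: lip1_extrapE1].
Qed.

Lemma lip1_defect s (c : 'cV[K]_s) P R j :
  lip1 (fun x => defect c P (peerQ c P R x) R x j).
Proof.
apply: lip1Z; first exact: lip1_cst.
apply: lip1B; last exact: lip1_cst.
apply: lip1B; last first.
  apply: lip1Z; last by apply: lip1_mulmx; [exact: lip1_peerQ|exact: lip1_cst].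
  by apply: (@lip1Z K (fun=> j%:R)); [exact: lip1_cst|exact: lip1XV].
apply: lip1B; first exact: lip1_cst.
by apply: lip1Z; [exact: lip1XV|exact: lip1_cst].
Qed.

Lemma lip1_extrap_defect s (c : 'cV[K]_s) E : lip1 (extrap_defect c E).
Proof.
apply: lip1Z; first exact: lip1_cst.
apply: lip1B; first exact: lip1_cst.
apply: lip1Z; first exact: lip1XV.
by apply: lip1_mulmx; [exact: lip1_extrapE1|exact: lip1_cst].
Qed.

End LipschitzAtOne.

(** * Stability *)

Section Stability.
Context {K : realType}.

(* With x' = x + D / 2, the recursion reads x'_i (1 - a_i) <= x'_(i-1) (1 + a_i),
   and (1 + a) / (1 - a) <= 1 + 4 a <= exp (4 a) for 0 <= a <= 1/2. *)
Lemma implicit_gronwall (x a : nat -> K) (D : K) n :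
  0 <= D -> 0 <= x 0%N ->
  (forall i, (i < n)%N -> 0 <= a i <= 2^-1) ->
  (forall i, (i < n)%N -> x i.+1 <= x i + a i * (x i.+1 + x i + D)) ->
  x n <= expR (4 * \sum_(i < n) a i) * (x 0%N + D / 2).
Proof.
move=> D0 x0 ha hx.
suff H : x n + D / 2 <= expR (4 * \sum_(i < n) a i) * (x 0%N + D / 2).
  by apply: le_trans H; rewrite lerDl divr_ge0.
elim: n ha hx => [|n IH] ha hx; first by rewrite big_ord0 mulr0 expR0 mul1r.
have /andP[a0 a2] := ha n (ltnSn n).
have {}IH := IH (fun i h => ha i (ltnW h)) (fun i h => hx i (ltnW h)).
rewrite big_ord_recr/= [4 * _]mulrDr expRD mulrAC.
set S := expR _ * _ in IH *; have S0 : 0 <= S.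
  by rewrite mulr_ge0 ?expR_ge0// addr_ge0// divr_ge0.
apply: (@le_trans _ _ (S * (1 + 4 * a n))); last first.
  by rewrite ler_wpM2l// expR_ge1Dx.
have a1 : 0 < 1 - a n by lra.
rewrite -(ler_pM2r a1); apply: (@le_trans _ _ ((x n + D / 2) * (1 + a n))).
  by have := hx n (ltnSn n); lra.
apply: (@le_trans _ _ (S * (1 + a n))); first by rewrite ler_wpM2r//; lra.
by rewrite -[leRHS]mulrA ler_wpM2l//; nra.
Qed.

(** Discrete variation of constants. The factor [s%:R] appears because the entrywise maximum norm is
    submultiplicative only up to the inner dimension. *)
Lemma power_bounded_recursion s m (P : 'M[K]_s) (M : K) (e : nat -> 'M[K]_(s, m)) n :
  (forall k, `|P ^+ k| <= M) ->
  `|e n| <= s%:R * M * (`|e 0%N| + \sum_(i < n) `|e i.+1 - P *m e i|).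
Proof.
move=> PM.
have -> : e n = P ^+ n *m e 0%N
     + \sum_(i < n) P ^+ (n.-1 - i) *m (e i.+1 - P *m e i).
  elim: n => [|n IH]; first by rewrite big_ord0 addr0 expr0 mul1mx.
  rewrite big_ord_recr/= subnn expr0 mul1mx -[LHS](subrK (P *m e n)) [LHS]addrC.
  rewrite [RHS]addrA; congr (_ + _).
  rewrite {1}IH mulmxDr exprS -mulmxA mulmx_sumr; congr (_ + _).
  apply: eq_bigr => i _; rewrite mulmxA; congr (_ *m _).
  have -> : (n - i = (n.-1 - i).+1)%N.
    by case: n {IH} i => [[]//|n] i; rewrite subSn -1?ltnS.
  by rewrite exprS.
have PA p (A : 'M[K]_(s, p)) k : `|P ^+ k *m A| <= s%:R * M * `|A|.
  by rewrite (le_trans (mulmx_norm_le _ _))// ler_wpM2r// ler_wpM2l.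
rewrite (le_trans (ler_normD _ _))// mulrDr lerD// mulr_sumr.
by rewrite (le_trans (ler_norm_sum _ _ _))// ler_sum.
Qed.

(** A recursion for [|e i|] itself would multiply by [|P|] at each step. The majorant [x i] from the
    variation of constants grows only by [k] times the current perturbation, which fits the implicit
    Gronwall lemma. *)
Lemma peer_stability s m (P : 'M[K]_s) (M L D : K) (e : nat -> 'M[K]_(s, m))
    (dt : nat -> K) n :
  (forall k, `|P ^+ k| <= M) -> 0 < L -> 0 <= D ->
  (forall i, (i < n)%N -> 0 <= dt i /\ s%:R * M * L * dt i <= 2^-1) ->
  (forall i, (i < n)%N ->
     `|e i.+1 - P *m e i| <= dt i * (L * (`|e i.+1| + `|e i|) + D)) ->
  `|e n| <= expR (4 * (s%:R * M * L * \sum_(i < n) dt i))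
            * (s%:R * M * `|e 0%N| + D / L / 2).
Proof.
move=> PM L0 D0 hdt he; set k := s%:R * M.
have M0 : 0 <= M by rewrite (le_trans _ (PM 0%N)).
have k0 : 0 <= k by rewrite mulr_ge0.
pose x i := k * (`|e 0%N| + \sum_(l < i) `|e l.+1 - P *m e l|).
have ex i : `|e i| <= x i by exact: power_bounded_recursion.
have xS i : x i.+1 = x i + k * `|e i.+1 - P *m e i|.
  by rewrite /x big_ord_recr/= addrA mulrDr.
apply: (le_trans (ex n)); rewrite mulr_sumr.
have -> : k * `|e 0%N| = x 0%N by rewrite /x big_ord0 addr0.
apply: (@implicit_gronwall x (fun i => k * L * dt i) (D / L) n)
  => [||i /hdt[dt0 dt2]|i ni].
- by rewrite divr_ge0// ltW.
- by rewrite (le_trans _ (ex 0%N)).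
- by rewrite dt2 !mulr_ge0// ltW.
- rewrite {1}xS lerD2l; have [dt0 _] := hdt i ni.
  have -> : k * L * dt i * (x i.+1 + x i + D / L) =
    k * (dt i * (L * (x i.+1 + x i) + D)) by field; rewrite gt_eqF.
  apply: ler_wpM2l => //; apply: (le_trans (he i ni)).
  by rewrite ler_wpM2l// lerD2r ler_wpM2l ?(ltW L0)// lerD.
Qed.

End Stability.

(* Local errors of the form dt^p (I - P) eta + O(dt H^p) are absorbed by the
   modified error eps - dt^p eta, for which they telescope up to O(dt H^p). *)
Lemma peer_superconvergence {K : realType} s m (P : 'M[K]_s) (M L B Cd Cr Ci T : K) p :
  (forall k, `|P ^+ k| <= M) -> 0 < L -> 0 <= B -> 0 <= Cd -> 0 <= Cr ->
  0 <= Ci ->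
  exists C h0 : K, 0 < h0 /\
    forall n (dt : nat -> K) (eps eta : nat -> 'M[K]_(s, m)) (H : K),
    H <= h0 -> (forall i, (i <= n)%N -> 0 < dt i <= H) ->
    \sum_(i < n) dt i.+1 <= T ->
    (forall i, (i <= n)%N -> `|eta i| <= B) ->
    (forall i, (i < n)%N ->
       `|dt i.+1 ^+ p *: eta i.+1 - dt i ^+ p *: eta i| <= Cd * (dt i.+1 * H ^+ p)) ->
    (forall i, (i < n)%N ->
       `|eps i.+1 - P *m eps i - dt i.+1 ^+ p *: ((1%:M - P) *m eta i.+1)| <=
       dt i.+1 * (L * (`|eps i.+1| + `|eps i|) + Cr * H ^+ p)) ->
    `|eps 0%N| <= Ci * H ^+ p ->
    `|eps n| <= C * H ^+ p.
Proof.
move=> PM L0 B0 Cd0 Cr0 Ci0.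
have M0 : 0 <= M by rewrite (le_trans _ (PM 0%N)).
set k := s%:R * M; have k0 : 0 <= k by rewrite mulr_ge0.
have kL0 : 0 <= k * L by rewrite mulr_ge0// ltW.
(* The three terms are the cost of replacing two errors [eps] by modified ones in the Lipschitz
   term, the given remainder, and [P] applied to the variation of [dt^p eta]. *)
pose D := L * (2 * B) + Cr + s%:R * `|P| * Cd.
have D0 : 0 <= D by rewrite /D !(addr_ge0, mulr_ge0)// ltW.
exists (expR (4 * (k * L * T)) * (k * (Ci + B) + D / L / 2) + B).
(* This bound gives [k * L * dt <= 1/2], as the implicit Gronwall lemma requires. *)
exists (2 * (k * L + 1))^-1; split; first by rewrite invr_gt0; lra.
move=> n dt eps eta H Hh0 hdt sdt heta hdeta heps heps0.
have H0 : 0 < H by have /andP[h1 h2] := hdt 0%N (leq0n _); exact: lt_le_trans h1 h2.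
have Hp0 : 0 <= H ^+ p by rewrite exprn_ge0// ltW.
pose e i := eps i - dt i ^+ p *: eta i.
have dte i : (i <= n)%N -> `|dt i ^+ p *: eta i| <= B * H ^+ p.
  move=> ni; have /andP[d0 dH] := hdt i ni.
  rewrite normrZ mulrC ler_pM ?heta// ger0_norm ?exprn_ge0 ?(ltW d0)//.
  by rewrite lerXn2r ?nnegrE ?(ltW d0) ?(ltW H0).
have epse i : (i <= n)%N -> `|eps i| <= `|e i| + B * H ^+ p.
  move=> ni; rewrite -{1}[eps i](subrK (dt i ^+ p *: eta i)).
  by rewrite (le_trans (ler_normD _ _))// lerD2l dte.
have e0 : `|e 0%N| <= (Ci + B) * H ^+ p.
  by rewrite mulrDl (le_trans (ler_normB _ _))// lerD// dte.
have /(_ n) := @peer_stability _ s m P M L (D * H ^+ p) e (fun i => dt i.+1).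
rewrite -/k => est.
apply: (le_trans (epse n (leqnn n))); rewrite mulrDl lerD2r.
apply: (le_trans (est _ _ _ _ _)) => //.
- by rewrite mulr_ge0.
- move=> i ni; have /andP[d0 dH] := hdt i.+1 ni; split; first exact: ltW.
  apply: (@le_trans _ _ (k * L * (2 * (k * L + 1))^-1)).
    by rewrite ler_wpM2l// (le_trans dH).
  have q0 : 0 < 2 * (k * L + 1) by lra.
  by rewrite ler_pdivrMr//; lra.
- move=> i ni; have /andP[d0 dH] := hdt i.+1 ni.
  have -> : e i.+1 - P *m e i =
      (eps i.+1 - P *m eps i - dt i.+1 ^+ p *: ((1%:M - P) *m eta i.+1))
      - P *m (dt i.+1 ^+ p *: eta i.+1 - dt i ^+ p *: eta i).
    rewrite /e !mulmxBr mulmxBl mul1mx -!scalemxAr scalerBr.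
    move: (P *m eps i) (P *m eta i) (P *m eta i.+1) => A1 A2 A3.
    by apply/matrixP => q r; rewrite !mxE; ring.
  apply: (le_trans (ler_normB _ _)).
  apply: (le_trans (lerD (heps i ni) (mulmx_norm_le _ _))).
  have := ler_wpM2l (mulr_ge0 (ler0n K s) (normr_ge0 P)) (hdeta i ni).
  have := ler_wpM2l (ltW L0) (lerD (epse i.+1 ni) (epse i (ltnW ni))).
  move/(ler_wpM2l (ltW d0)) => h1 h2.
  by rewrite /D; lra.
- rewrite -[leRHS]mulrA; apply: ler_pM; rewrite ?expR_ge0//.
    by rewrite addr_ge0 ?mulr_ge0// ?invr_ge0 ?(ltW L0).
    by rewrite ler_expR ler_wpM2l// ler_wpM2l.
  rewrite [leRHS]mulrDl lerD//; first by rewrite -mulrA ler_wpM2l.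
  by rewrite [leRHS]mulrAC [D / L * _]mulrAC.
Qed.

(** * Local error *)

Section StageTaylor.
Context {K : realType} {s m : nat}.

Definition vderiv_chain (a b : K) k (phi : nat -> K -> 'rV[K]_m) :=
  forall l, deriv_chain a b k (fun j t => phi j t 0 l).

Lemma smooth_vderiv_chain (a b : K) k (f : K -> 'rV[K]_m) :
  (forall l, smooth a b k (fun t => f t 0 l)) ->
  exists2 phi, phi 0%N = f & vderiv_chain a b k phi.
Proof.
move=> sf; have /choice[psi Hpsi] : forall l : 'I_m, exists psi : nat -> K -> K,
    psi 0%N = (fun t => f t 0 l) /\ deriv_chain a b k psi.
  by move=> l; have [psi p1 p2] := smooth_deriv_chain (sf l); exists psi.
exists (fun j t => \row_l psi l j t).
  by apply/funext => t; apply/rowP => l; rewrite mxE (Hpsi l).1.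
move=> l; under [X in deriv_chain _ _ _ X]funext => j.
  by under eq_fun do rewrite mxE; over.
exact: (Hpsi l).2.
Qed.

(** Nodes [c] with step [h] give the new stages, nodes [c - e] with step [h / sigma] the old ones,
    about the same centre [t]. *)
Definition stages (z : 'cV[K]_s) h (f : K -> 'rV[K]_m) t : 'M[K]_(s, m) :=
  \matrix_(i < s) f (t + z i 0 * h).

Lemma stages_taylor (a b a' b' Z : K) k phi : a < a' -> b' < b -> 0 <= Z ->
  vderiv_chain a b k phi ->
  exists2 M : K, 0 <= M & forall (z : 'cV[K]_s) t h,
    `|z| <= Z -> 0 <= h -> a' <= t <= b' ->
    (forall i, a' <= t + z i 0 * h <= b') ->
    `|stages z h (phi 0%N) t - stage_taylor z h k (fun j => phi j t)| <= M * h ^+ k.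
Proof.
move=> aa' bb' Z0 ch.
have /choice[M HM] : forall l : 'I_m, exists M : K, 0 <= M /\
    forall t x, a' <= t <= b' -> a' <= t + x <= b' ->
    `|phi 0%N (t + x) 0 l - \sum_(j < k) x ^+ j / j`!%:R * phi j t 0 l|
      <= M * `|x| ^+ k.
  by move=> l; have [M M0 HM] := deriv_chain_taylor aa' bb' (ch l); exists M.
have S0 : 0 <= \sum_l M l by apply: sumr_ge0 => l _; have [] := HM l.
exists ((\sum_l M l) * Z ^+ k); first by rewrite mulr_ge0// exprn_ge0.
move=> z t h zZ h0 tab zab; apply: mx_norm_le => [|i l].
  by rewrite !mulr_ge0// exprn_ge0.
have -> : (stages z h (phi 0%N) t - stage_taylor z h k (fun j => phi j t)) i l =
    phi 0%N (t + z i 0 * h) 0 l -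
    \sum_(j < k) (z i 0 * h) ^+ j / j`!%:R * phi j t 0 l.
  rewrite !mxE summxE; congr (_ - _); apply: eq_bigr => j _.
  rewrite mxE [X in _ * X]mxE big_ord1 mxE exprMn.
  by rewrite -!mulrA [RHS]mulrCA; congr (_ * _); rewrite mulrCA.
rewrite (le_trans ((HM l).2 _ _ tab (zab i)))// -mulrA.
apply: ler_pM; rewrite ?exprn_ge0 ?(HM l).1//.
  by rewrite (bigD1 l)//= lerDl sumr_ge0// => l' _; have [] := HM l'.
rewrite -exprMn lerXn2r ?nnegrE ?mulr_ge0// normrM (ger0_norm h0) ler_wpM2r//.
exact: le_trans (mx_norm_entry _ _ _) zZ.
Qed.

(** Both bounds are Taylor estimates of the [k]-th derivative, of order 0 and of order 1. *)
Lemma vderiv_chain_bounded_lipschitz (a b a' b' : K) k phi :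
  a < a' -> b' < b -> vderiv_chain a b k.+1 phi ->
  exists2 M : K, 0 <= M &
    (forall t, a' <= t <= b' -> `|phi k t| <= M) /\
    (forall t t', a' <= t <= b' -> a' <= t' <= b' ->
       `|phi k t - phi k t'| <= M * `|t - t'|).
Proof.
move=> aa' bb' ch.
have /choice[M HM] : forall l : 'I_m, exists M : K, 0 <= M /\
    (forall t, a' <= t <= b' -> `|phi k t 0 l| <= M) /\
    (forall t t', a' <= t <= b' -> a' <= t' <= b' ->
       `|phi k t 0 l - phi k t' 0 l| <= M * `|t - t'|).
  move=> l; have chl := ch l; rewrite -addn1 in chl.
  have := deriv_chain_shiftn chl => {}chl.
  have [M M0 HM] := deriv_chain_taylor aa' bb' chl.
  have [N N0 HN] := deriv_chain_taylor aa' bb' (deriv_chain_trunc (leq0n 1) chl).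
  exists (M + N); split; first by rewrite addr_ge0.
  split=> [t tab|t t' tab tab'].
    have := HN t 0 tab; rewrite addr0 => /(_ tab); rewrite big_ord0 subr0 addn0.
    by rewrite expr0 mulr1 => /le_trans; apply; rewrite lerDr.
  have := HM t' (t - t') tab'; rewrite addrC subrK => /(_ tab).
  rewrite big_ord_recl big_ord0 expr0 fact0 divr1 mul1r addr0 addn0 expr1.
  by move=> /le_trans; apply; rewrite ler_wpM2r// lerDl.
have S0 : 0 <= \sum_l M l by apply: sumr_ge0 => l _; have [] := HM l.
have MS l : M l <= \sum_l M l.
  by rewrite (bigD1 l)//= lerDl sumr_ge0// => l' _; have [] := HM l'.
exists (\sum_l M l) => //; split=> [t tab|t t' tab tab'].
  apply: mx_norm_le => // i l; rewrite ord1 (le_trans _ (MS l))//.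
  have [_ [H _]] := HM l; exact: H.
apply: mx_norm_le => [|i l]; first by rewrite mulr_ge0.
rewrite ord1 mxE [X in _ + X]mxE.
apply: (@le_trans _ _ (M l * `|t - t'|)); last by rewrite ler_wpM2r.
have [_ [_ H]] := HM l; exact: H.
Qed.

End StageTaylor.

(** [G] and [H] are the values of [F0] and [F1], a suffix [p] marks the previous step, a prefix [T]
    a Taylor polynomial ([TF] for the sum). The IMEX residual is the implicit residual plus [h R]
    times the extrapolation error of [G]; each splits into its polynomial part [X1], [X2] and Taylor
    tails. *)
Lemma imex_residual_split {K : realType} {s m : nat} (P Q R E E1 : 'M[K]_s) (h : K)
    (W Wp G Gp H Hp TW TWp TF TFp TG TGp X1 X2 : 'M[K]_(s, m)) :
  TW - P *m TWp - h *: (Q *m TFp + R *m TF) = X1 ->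
  (1%:M - E) *m TG - E1 *m TGp = X2 ->
  W - P *m Wp - h *: ((Q + R *m E1) *m Gp + R *m E *m G + Q *m Hp + R *m H) =
  X1 + h *: (R *m X2) + ((W - TW) - P *m (Wp - TWp)
    - h *: (Q *m ((Gp + Hp) - TFp) + R *m ((G + H) - TF))
    + h *: (R *m ((1%:M - E) *m (G - TG) - E1 *m (Gp - TGp)))).
Proof.
move=> <- <-.
rewrite !(mulmxBl, mulmxBr, mulmxDl, mulmxDr, mulmxN, mulNmx, mul1mx) !mulmxA.
move: (P *m Wp) (P *m TWp) (Q *m Gp) (Q *m Hp) (Q *m TFp) (R *m E1 *m Gp)
  (R *m E1 *m TGp) (R *m E *m G) (R *m E *m TG) (R *m G) (R *m H) (R *m TG)
  (R *m TF) => A1 A2 A3 A4 A5 A6 A7 A8 A9 A10 A11 A12 A13.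
apply/matrixP => i j; rewrite !mxE; ring.
Qed.

Definition imex_increment {K : realType} {s m : nat} (c : 'cV[K]_s) (P R E : 'M[K]_s)
    (F0 F1 : 'rV[K]_m -> 'rV[K]_m) sigma (Wp W : 'M[K]_(s, m)) : 'M[K]_(s, m) :=
  Qhat c P R E sigma *m stagewise F0 Wp + Rhat R E *m stagewise F0 W
  + peerQ c P R sigma *m stagewise F1 Wp + R *m stagewise F1 W.

Lemma stagewise_lipschitz {K : realType} {s m : nat} (F : 'rV[K]_m -> 'rV[K]_m)
    (L : K) (X Y : 'M[K]_(s, m)) : 0 <= L ->
  (forall x y, `|F x - F y| <= L * `|x - y|) ->
  `|stagewise F X - stagewise F Y| <= L * `|X - Y|.
Proof.
move=> L0 FL; apply: mx_norm_le => [|i j]; first by rewrite mulr_ge0.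
have -> : (stagewise F X - stagewise F Y) i j = (F (row i X) - F (row i Y)) 0 j.
  by rewrite !mxE.
rewrite (le_trans (mx_norm_entry _ _ _))// (le_trans (FL _ _))// ler_wpM2l//.
apply: mx_norm_le => // i' j'; apply: le_trans (mx_norm_entry _ i j').
by rewrite !mxE.
Qed.

Lemma imex_increment_lipschitz {K : realType} {s m : nat} (c : 'cV[K]_s)
    (P R E : 'M[K]_s) (F0 F1 : 'rV[K]_m -> 'rV[K]_m) (L : K) : 0 <= L ->
  (forall x y, `|F0 x - F0 y| <= L * `|x - y|) ->
  (forall x y, `|F1 x - F1 y| <= L * `|x - y|) ->
  exists2 L' : K, 0 < L' & forall sigma, 2^-1 <= sigma <= 2 ->
    forall Wp W wp w : 'M[K]_(s, m),
    `|imex_increment c P R E F0 F1 sigma Wp W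
      - imex_increment c P R E F0 F1 sigma wp w|
      <= L' * (`|W - w| + `|Wp - wp|).
Proof.
move=> L0 F0L F1L.
have [BQ BQ0 HQ] := lip1_bounded (lip1_peerQ c P R).
have [BH BH0 HH] := lip1_bounded (lip1_Qhat c P R E).
pose k := s%:R * L; have k0 : 0 <= k by rewrite mulr_ge0.
have lipF F (A : 'M[K]_s) B (X Y : 'M[K]_(s, m)) : `|A| <= B ->
    (forall x y, `|F x - F y| <= L * `|x - y|) ->
    `|A *m (stagewise F X - stagewise F Y)| <= B * (k * `|X - Y|).
  move=> AB FL; rewrite (le_trans (mulmx_norm_le _ _))//.
  have -> : B * (k * `|X - Y|) = s%:R * B * (L * `|X - Y|) by rewrite /k; ring.
  by rewrite ler_pM ?mulr_ge0 ?stagewise_lipschitz// ler_wpM2l.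
exists (k * (BH + `|Rhat R E| + BQ + `|R|) + 1).
  by rewrite ltr_wpDl// mulr_ge0// !addr_ge0.
move=> sigma s2 Wp W wp w.
have -> : imex_increment c P R E F0 F1 sigma Wp W
      - imex_increment c P R E F0 F1 sigma wp w =
  Qhat c P R E sigma *m (stagewise F0 Wp - stagewise F0 wp)
  + Rhat R E *m (stagewise F0 W - stagewise F0 w)
  + peerQ c P R sigma *m (stagewise F1 Wp - stagewise F1 wp)
  + R *m (stagewise F1 W - stagewise F1 w).
  rewrite !mulmxBr /imex_increment; move: (_ *m _) (_ *m _) (_ *m _) (_ *m _)
    (_ *m _) (_ *m _) (_ *m _) (_ *m _) => A1 A2 A3 A4 A5 A6 A7 A8.
  by apply/matrixP => i j; rewrite !mxE; ring.
rewrite (le_trans (ler_normD _ _))//.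
apply: (le_trans (lerD (ler_normD _ _) (lipF _ _ _ _ _ (lexx _) F1L))).
apply: (le_trans (lerD (lerD (ler_normD _ _) (lipF _ _ _ _ _ (HQ _ s2) F1L)) (lexx _))).
apply: (le_trans (lerD (lerD (lerD (lipF _ _ _ _ _ (HH _ s2) F0L)
  (lipF _ _ _ _ _ (lexx _) F0L)) (lexx _)) (lexx _))).
set x := `|W - w|; set y := `|Wp - wp|; set r := `|R|; set rh := `|Rhat R E|.
have [x0 y0 r0 rh0] : [/\ 0 <= x, 0 <= y, 0 <= r & 0 <= rh] by split; exact: normr_ge0.
have -> : (k * (BH + rh + BQ + r) + 1) * (x + y) =
  BH * (k * y) + rh * (k * x) + BQ * (k * y) + r * (k * x)
  + (BH * (k * x) + rh * (k * y) + BQ * (k * x) + r * (k * y) + (x + y)) by ring.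
by rewrite lerDl !addr_ge0 ?mulr_ge0.
Qed.

(** * Order estimates uniform over a parameter set *)

Section BigO.
Context {K : realType} {T : Type} (V : T -> Prop).

Definition is_bigO (g : T -> K) (W : normedModType K) (f : T -> W) :=
  exists2 C : K, 0 <= C & forall x, V x -> `|f x| <= C * g x.

Lemma bigO_le (g g' : T -> K) C (W : normedModType K) (f : T -> W) : 0 <= C ->
  (forall x, V x -> g x <= C * g' x) -> is_bigO g f -> is_bigO g' f.
Proof.
move=> C0 gg' [D D0 HD]; exists (D * C) => [|x Vx]; first by rewrite mulr_ge0.
by rewrite (le_trans (HD x Vx))// -mulrA ler_wpM2l ?gg'.
Qed.

Lemma bigOD g (W : normedModType K) (f f' : T -> W) :
  is_bigO g f -> is_bigO g f' -> is_bigO g (fun x => f x + f' x).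
Proof.
move=> [C C0 HC] [D D0 HD]; exists (C + D) => [|x Vx]; first by rewrite addr_ge0.
by rewrite (le_trans (ler_normD _ _))// mulrDl lerD ?HC ?HD.
Qed.

Lemma bigON g (W : normedModType K) (f : T -> W) :
  is_bigO g f -> is_bigO g (fun x => - f x).
Proof. by move=> [C C0 HC]; exists C => // x Vx; rewrite normrN HC. Qed.

Lemma bigOB g (W : normedModType K) (f f' : T -> W) :
  is_bigO g f -> is_bigO g f' -> is_bigO g (fun x => f x - f' x).
Proof. by move=> Of Of'; apply: bigOD; last exact: bigON. Qed.

Lemma bigO_cst (W : normedModType K) (v : W) : is_bigO (fun=> 1) (fun=> v).
Proof. by exists `|v| => // x _; rewrite mulr1. Qed.

Lemma bigOZ g (W : normedModType K) (k : T -> K) (f : T -> W) :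
  (forall x, V x -> 0 <= k x) ->
  is_bigO g f -> is_bigO (fun x => k x * g x) (fun x => k x *: f x).
Proof.
move=> k0 [C C0 HC]; exists C => // x Vx.
by rewrite normrZ ger0_norm ?k0// mulrCA ler_wpM2l ?HC ?k0.
Qed.

Lemma bigO_mulmx g g' p q r (f : T -> 'M[K]_(p, q)) (f' : T -> 'M[K]_(q, r)) :
  is_bigO g f -> is_bigO g' f' ->
  is_bigO (fun x => g x * g' x) (fun x => f x *m f' x).
Proof.
move=> [C C0 HC] [D D0 HD]; exists (q%:R * (C * D)) => [|x Vx].
  by rewrite !mulr_ge0.
rewrite (le_trans (mulmx_norm_le _ _))// -!mulrA ler_wpM2l// mulrA mulrACA.
by rewrite ler_pM ?HC ?HD.
Qed.

Lemma bigO_mulmx_bounded g p q r (f : T -> 'M[K]_(p, q)) (f' : T -> 'M[K]_(q, r)) :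
  is_bigO (fun=> 1) f -> is_bigO g f' -> is_bigO g (fun x => f x *m f' x).
Proof.
move=> Of Of'; have := bigO_mulmx Of Of'.
by under [X in is_bigO X _ -> _]funext do rewrite mul1r.
Qed.

Lemma lip1_bigO (W : normedModType K) (f : K -> W) (sigma : T -> K) :
  (forall x, V x -> 2^-1 <= sigma x <= 2) -> lip1 f ->
  is_bigO (fun x => `|sigma x - 1|) (fun x => f (sigma x) - f 1).
Proof. by move=> hs [M M0 HM]; exists M => // x Vx; rewrite HM ?hs. Qed.

Lemma lip1_bigO1 (W : normedModType K) (f : K -> W) (sigma : T -> K) :
  (forall x, V x -> 2^-1 <= sigma x <= 2) -> lip1 f ->
  is_bigO (fun=> 1) (fun x => f (sigma x)).
Proof.
move=> hs /lip1_bounded[B B0 HB]; exists B => // x Vx.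
by rewrite mulr1 HB ?hs.
Qed.

End BigO.

(** * Expansion of the IMEX residual *)

Section Consistency.
Context {K : realType} {s m : nat} (c : 'cV[K]_s) (P R E : 'M[K]_s).
Hypothesis c_distinct : forall i j : 'I_s, i != j -> c i 0 != c j 0.
Hypothesis P_ones : P *m ones K s = ones K s.
Context (alpha beta : 'cV[K]_s).
Hypothesis alphaP :
  defect c P (peerQ c P R 1) R 1 s.+1 = (1%:M - P) *m alpha.
Hypothesis betaP : R *m extrap_defect c E 1 = (1%:M - P) *m beta.
Context (F0 F1 : 'rV[K]_m -> 'rV[K]_m) (phi gam : nat -> K -> 'rV[K]_m).
Context (a b a' b' Z : K).
Hypotheses (aa' : a < a') (bb' : b' < b) (Z0 : 0 <= Z).
Hypotheses (cZ : `|c| <= Z) (ceZ : `|c - ones K s| <= Z).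
Hypothesis phi_chain : vderiv_chain a b s.+2 phi.
Hypothesis gam_chain : vderiv_chain a b s.+1 gam.
Hypothesis phi1E : forall t, a < t < b ->
  phi 1%N t = F0 (phi 0%N t) + F1 (phi 0%N t).
Hypothesis gam0E : forall t, a < t < b -> gam 0%N t = F0 (phi 0%N t).

Definition imex_residual sigma h (Wp W : 'M[K]_(s, m)) : 'M[K]_(s, m) :=
  W - P *m Wp - h *: imex_increment c P R E F0 F1 sigma Wp W.

Context {T : Type} (V : T -> Prop) (t h sigma : T -> K).
Hypothesis h_ge0 : forall x, V x -> 0 <= h x.
Hypothesis sigma_bnd : forall x, V x -> 2^-1 <= sigma x <= 2.
Hypothesis t_in : forall x, V x -> a' <= t x <= b'.
Hypothesis tc_in : forall x, V x -> forall i, a' <= t x + c i 0 * h x <= b'.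
Hypothesis tce_in : forall x, V x ->
  forall i, a' <= t x + (c - ones K s) i 0 * (h x / sigma x) <= b'.
Hypothesis stage_order_s : forall x, V x -> forall j, (1 <= j <= s)%N ->
  defect c P (peerQ c P R (sigma x)) R (sigma x) j = 0.

Let W x := stages c (h x) (phi 0%N) (t x).
Let Wp x := stages (c - ones K s) (h x / sigma x) (phi 0%N) (t x).
Let g x := h x ^+ s.+1 * (h x + `|sigma x - 1|).

Let taylor_c k (psi : nat -> K -> 'rV[K]_m) :
  vderiv_chain a b k psi -> is_bigO V (fun x => h x ^+ k)
  (fun x => stages c (h x) (psi 0%N) (t x)
            - stage_taylor c (h x) k (fun j => psi j (t x))).
Proof.
move=> ch; have [M M0 HM] := @stages_taylor K s m _ _ _ _ _ _ _ aa' bb' Z0 ch.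
by exists M => // x Vx; exact: (HM _ _ _ cZ (h_ge0 Vx) (t_in Vx) (tc_in Vx)).
Qed.

Let taylor_ce k (psi : nat -> K -> 'rV[K]_m) :
  vderiv_chain a b k psi -> is_bigO V (fun x => h x ^+ k)
  (fun x => stages (c - ones K s) (h x / sigma x) (psi 0%N) (t x)
     - stage_taylor (c - ones K s) (h x / sigma x) k (fun j => psi j (t x))).
Proof.
move=> ch; have [M M0 HM] := @stages_taylor K s m _ _ _ _ _ _ _ aa' bb' Z0 ch.
apply: (@bigO_le _ _ _ (fun x => (h x / sigma x) ^+ k) _ (2 ^+ k)).
- by rewrite exprn_ge0.
- move=> x Vx; have /andP[s1 s2] := sigma_bnd Vx; have h0 := h_ge0 Vx.
  have sig0 : 0 < sigma x by lra.
  rewrite -exprMn lerXn2r ?nnegrE ?mulr_ge0 ?invr_ge0 ?(ltW sig0)//.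
  by rewrite [leRHS]mulrC ler_wpM2l// -[leRHS]invrK lef_pV2 ?posrE ?invr_gt0.
- exists M => // x Vx; have /andP[s1 s2] := sigma_bnd Vx.
  have hs0 : 0 <= h x / sigma x by rewrite divr_ge0 ?h_ge0//; lra.
  exact: (HM _ _ _ ceZ hs0 (t_in Vx) (tce_in Vx)).
Qed.

Let stagewise0 (z : 'cV[K]_s) hh tt :
  (forall i, a' <= tt + z i 0 * hh <= b') ->
  stagewise F0 (stages z hh (phi 0%N) tt) = stages z hh (gam 0%N) tt :> 'M[K]_(s, m).
Proof.
move=> Hz; apply/matrixP => i j; rewrite !mxE gam0E; last first.
  by have /andP[h1 h2] := Hz i; rewrite (lt_le_trans aa' h1) (le_lt_trans h2).
by congr (F0 _ _ _); apply/rowP => l; rewrite !mxE.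
Qed.

Let stagewise01 (z : 'cV[K]_s) hh tt :
  (forall i, a' <= tt + z i 0 * hh <= b') ->
  stagewise F0 (stages z hh (phi 0%N) tt) + stagewise F1 (stages z hh (phi 0%N) tt)
    = stages z hh (phi 1%N) tt :> 'M[K]_(s, m).
Proof.
move=> Hz; apply/matrixP => i j; rewrite !mxE phi1E; last first.
  by have /andP[h1 h2] := Hz i; rewrite (lt_le_trans aa' h1) (le_lt_trans h2).
rewrite mxE; have -> // : row i (stages z hh (phi 0%N) tt) = phi 0%N (tt + z i 0 * hh).
by apply/rowP => l; rewrite !mxE.
Qed.

Lemma imex_residual_bigO : is_bigO V g (fun x =>
  imex_residual (sigma x) (h x) (Wp x) (W x)
  - h x ^+ s.+1 *: ((1%:M - P) *m (alpha *m phi s.+1 (t x) + beta *m gam s (t x)))).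
Proof.
pose Q x := peerQ c P R (sigma x).
pose rW x := W x - stage_taylor c (h x) s.+2 (fun j => phi j (t x)).
pose rWp x := Wp x
  - stage_taylor (c - ones K s) (h x / sigma x) s.+2 (fun j => phi j (t x)).
pose rF x := stages c (h x) (phi 1%N) (t x)
  - stage_taylor c (h x) s.+1 (fun j => phi j.+1 (t x)).
pose rFp x := stages (c - ones K s) (h x / sigma x) (phi 1%N) (t x)
  - stage_taylor (c - ones K s) (h x / sigma x) s.+1 (fun j => phi j.+1 (t x)).
pose rG x := stages c (h x) (gam 0%N) (t x)
  - stage_taylor c (h x) s.+1 (fun j => gam j (t x)).
pose rGp x := stages (c - ones K s) (h x / sigma x) (gam 0%N) (t x)
  - stage_taylor (c - ones K s) (h x / sigma x) s.+1 (fun j => gam j (t x)).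
pose A x := defect c P (peerQ c P R x) R x s.+1.
pose B x := extrap_defect c E x.
(* The first summand is the price of evaluating the coefficients at ratio 1, the rest are Taylor
   tails. Tails multiplied by [h] are cut one order earlier, so all of them are of size
   [h^(s+2)]. *)
pose f x := h x ^+ s.+1 *: ((A (sigma x) - A 1) *m phi s.+1 (t x)
    + R *m ((B (sigma x) - B 1) *m gam s (t x)))
  + (rW x - P *m rWp x - h x *: (Q x *m rFp x + R *m rF x)
  + h x *: (R *m ((1%:M - E) *m rG x - extrapE1 c E (sigma x) *m rGp x))).
have residualE x : V x -> imex_residual (sigma x) (h x) (Wp x) (W x)
  - h x ^+ s.+1 *: ((1%:M - P) *m (alpha *m phi s.+1 (t x) + beta *m gam s (t x)))
  = f x.
  move=> Vx; have /andP[s1 s2] := sigma_bnd Vx.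
  have sig0 : sigma x != 0 by rewrite gt_eqF//; lra.
  rewrite /imex_residual /imex_increment /Qhat /Rhat.
  have := @peer_taylor_residual _ _ m c P (Q x) R _ (h x) (fun j => phi j (t x))
    s.+1 sig0 P_ones.
  (* Stage order removes all terms but the last, whose coefficient is the defect of index
     [s + 1]. *)
  rewrite big_ord_recr/= big1 ?add0r => [X1|j _]; last first.
    by rewrite (stage_order_s Vx (j := j.+1)) ?ltn_ord ?mul0mx ?scaler0.
  have X2 := @extrap_taylor_residual _ _ m c E _ (h x) (fun j => gam j (t x))
    c_distinct sig0.
  rewrite (imex_residual_split _ _ _ _ _ _ X1 X2).
  rewrite /W /Wp !stagewise01 ?stagewise0; try by [exact: tc_in|exact: tce_in].
  rewrite -/(W x) -/(Wp x) /f -/(rW x) -/(rWp x).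
  rewrite -/(rF x) -/(rFp x) -/(rG x) -/(rGp x) addrAC; congr (_ + _).
  rewrite -/(A (sigma x)) -/(B (sigma x)) -scalemxAr scalerA -exprS.
  rewrite -!scalerDr -scalerBr; congr (_ *: _).
  rewrite mulmxDr !mulmxA -alphaP -betaP -/(A 1) -/(B 1) !mulmxBl.
  by rewrite mulmxBr mulmxBl opprD addrACA.
suff : is_bigO V g f.
  by move=> [C C0 HC]; exists C => // x Vx; rewrite residualE// HC.
have hle k (u : T -> 'M[K]_(s, m)) : k = s.+2 -> is_bigO V (fun x => h x ^+ k) u ->
    is_bigO V g u.
  move=> ->; apply: (@bigO_le _ _ _ _ _ 1) => // x Vx.
  by rewrite mul1r /g exprSr ler_wpM2l ?exprn_ge0 ?h_ge0// lerDl.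
have sle (u : T -> 'M[K]_(s, m)) :
    is_bigO V (fun x => h x ^+ s.+1 * `|sigma x - 1|) u -> is_bigO V g u.
  apply: (@bigO_le _ _ _ _ _ 1) => // x Vx.
  by rewrite mul1r /g ler_wpM2l ?exprn_ge0 ?h_ge0// lerDr h_ge0.
have hZ (u : T -> 'M[K]_(s, m)) : is_bigO V (fun x => h x ^+ s.+1) u ->
    is_bigO V g (fun x => h x *: u x).
  move=> Ou; apply: (hle s.+2) => //.
  by under [X in is_bigO _ X]funext do rewrite exprS; exact: bigOZ.
have bounded_chain k (psi : nat -> K -> 'rV[K]_m) : vderiv_chain a b k.+1 psi ->
    is_bigO V (fun=> 1) (fun x => psi k (t x)).
  move=> ch; have [M M0 [HM _]] := vderiv_chain_bounded_lipschitz aa' bb' ch.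
  by exists M => // x Vx; rewrite mulr1 HM ?t_in.
have lip1_prod (N : K -> 'cV[K]_s) k (psi : nat -> K -> 'rV[K]_m) :
    lip1 N -> vderiv_chain a b k.+1 psi ->
    is_bigO V (fun x => `|sigma x - 1|)
      (fun x => (N (sigma x) - N 1) *m psi k (t x)).
  move=> lN /bounded_chain ch.
  have := bigO_mulmx (lip1_bigO sigma_bnd lN) ch.
  by under [X in is_bigO _ X _ -> _]funext do rewrite mulr1.
have cstO p q (M : 'M[K]_(p, q)) : is_bigO V (fun=> 1) (fun=> M) by exact: bigO_cst.
apply: bigOD.
  apply: sle; apply: bigOZ; first by move=> x Vx; rewrite exprn_ge0 ?h_ge0.
  apply: bigOD; first by apply: lip1_prod => //; exact: lip1_defect.
  by apply: bigO_mulmx_bounded => //; apply: lip1_prod => //; exact: lip1_extrap_defect.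
apply: bigOD; last first.
  apply: hZ; apply: bigO_mulmx_bounded => //; apply: bigOB.
    by apply: bigO_mulmx_bounded => //; exact: taylor_c.
  apply: bigO_mulmx_bounded; last exact: taylor_ce.
  exact: lip1_bigO1 sigma_bnd (lip1_extrapE1 _ _).
apply: bigOB.
  apply: bigOB; first by apply: (hle s.+2) => //; exact: taylor_c.
  by apply: bigO_mulmx_bounded => //; apply: (hle s.+2) => //; exact: taylor_ce.
have phi_chain1 l := deriv_chain_shift (phi_chain l).
apply: hZ; apply: bigOD.
  apply: bigO_mulmx_bounded; first exact: lip1_bigO1 sigma_bnd (lip1_peerQ _ _ _).
  exact: (@taylor_ce _ (fun j => phi j.+1)).
by apply: bigO_mulmx_bounded => //; exact: (@taylor_c _ (fun j => phi j.+1)).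
Qed.

End Consistency.

(** * Convergence *)

(** [lipschitz] asserts the bound for all sufficiently large constants; [|M| + 1] is one of them and
    is nonnegative. *)
Lemma lipschitz_le {K : realType} (V W : normedModType K) (F : V -> W) :
  lipschitz F -> exists2 L : K, 0 <= L & forall x y, `|F x - F y| <= L * `|x - y|.
Proof.
move=> [M [_ HM]]; exists (`|M| + 1); first by rewrite addr_ge0.
move=> x y; have /(HM _) H : M < `|M| + 1 by rewrite (le_lt_trans (ler_norm M))// ltrDl.
exact: (H (x, y)).
Qed.

(** The theorem controls [dt_(i-1) / dt_i], the reciprocal of the step size ratio; inverting costs a
    factor 2. *)
Lemma ratio_near1 {K : realType} (x y kappa : K) : 0 < x -> 0 < y ->
  `|x / y - 1| <= kappa -> kappa <= 2^-1 ->
  2^-1 <= y / x <= 2 /\ `|y / x - 1| <= 2 * kappa.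
Proof.
move=> x0 y0 xy k2; have yx : y / x = (x / y)^-1 by rewrite invf_div.
have r0 : 0 < x / y by rewrite divr_gt0.
rewrite yx; move: (x / y) xy r0 => r + r0.
move=> rk; have /andP[h1 h2] : - kappa <= r - 1 <= kappa by rewrite -ler_norml.
have rV2 : r^-1 <= 2 by rewrite -[leRHS]invrK lef_pV2 ?posrE ?invr_gt0//; lra.
split.
  by rewrite rV2 andbT lef_pV2 ?posrE//; lra.
have -> : r^-1 - 1 = r^-1 * (1 - r) by rewrite mulrBr mulr1 mulVf ?gt_eqF.
rewrite normrM distrC ger0_norm ?invr_ge0 ?(ltW r0)//.
by rewrite ler_pM// invr_ge0 ltW.
Qed.

Lemma tgrid_ge0 {K : realType} (dt : nat -> K) n :
  (forall i, (i < n)%N -> 0 < dt i) -> 0 <= tgrid dt n.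
Proof. by move=> dt0; apply: sumr_ge0 => i _; rewrite ltW ?dt0. Qed.

Lemma tgridS {K : realType} (dt : nat -> K) n : tgrid dt n.+1 = tgrid dt n + dt n.
Proof. by rewrite /tgrid big_ord_recr. Qed.

Lemma tgrid_le {K : realType} (dt : nat -> K) n i :
  (forall i, (i < n)%N -> 0 < dt i) -> (i <= n)%N -> tgrid dt i <= tgrid dt n.
Proof.
elim: n => [|n IH] dt0; first by rewrite leqn0 => /eqP->.
rewrite leq_eqVlt => /predU1P[->//|lein].
rewrite tgridS (le_trans (IH _ lein)) ?lerDl ?ltW ?dt0// => j jn.
exact: dt0 (ltnW jn).
Qed.

Lemma dtmax_ge {K : realType} (dt : nat -> K) n i : (i <= n)%N -> dt i <= dtmax dt n.
Proof.
move=> lein; have := @le_bigmax _ _ _ (dt 0%N) (fun j : 'I_n.+1 => dt j) (inord i).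
by rewrite inordK.
Qed.

Theorem theorem2p5 (K : realType) (s m : nat) (hs : (0 < s)%N)
  (* the method *)
  (c : 'cV[K]_s) (P R E2 : 'M[K]_s) (gamma sigma_min sigma_max : K)
  (c_distinct : forall i j : 'I_s, i != j -> c i 0 != c j 0)
  (c_last : forall i : 'I_s, i.+1 = s -> c i 0 = 1)
  (R_lower : forall i j : 'I_s, (i < j)%N -> R i j = 0)
  (gamma_gt0 : 0 < gamma)
  (R_diag : forall i : 'I_s, R i i = gamma)
  (E2_strict_lower : forall i j : 'I_s, (i <= j)%N -> E2 i j = 0)
  (sigma_min_ge0 : 0 <= sigma_min)
  (P_zero_stable : zero_stable P)
  (order_s : stage_order c P (peerQ c P R) R sigma_min sigma_max s)
  (cond_V : forall v : 'cV[K]_s, (1%:M - P^T) *m v = 0 ->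
     v^T *m ((Cmx c - 1%:M) *m V1 c *m Dtilde K s *m invmx (V1 c)
             *m cpow (c - ones K s) s) = 0)
  (cond_R : forall v : 'cV[K]_s, (1%:M - P^T) *m v = 0 ->
     forall j : nat, (2 <= j <= s.+1)%N ->
     v^T *m (cpow c j - j%:R *: (R *m cpow c j.-1)) = 0)
  (cond_E : forall v : 'cV[K]_s, (1%:M - P^T) *m v = 0 ->
     forall j : nat, (2 <= j <= s.+1)%N ->
     v^T *m (R *m (E2 - 1%:M) *m cpow c j.-1) = 0)
  (* the problem; the time interval [0, T] lies inside ]a, b[ *)
  (F0 F1 : 'rV[K]_m -> 'rV[K]_m) (u : K -> 'rV[K]_m) (u0 : 'rV[K]_m)
  (a b T : K) (a_lt0 : a < 0) (T_ge0 : 0 <= T) (T_lt_b : T < b)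
  (F0_smooth : cont_diff s.+1 [set: 'rV[K]_m] F0)
  (F1_smooth : cont_diff s.+1 [set: 'rV[K]_m] F1)
  (F0_lipschitz : lipschitz F0)
  (F1_lipschitz : lipschitz F1)
  (u_smooth : cont_diff s.+2 [set t : K | a < t < b] u)
  (u_init : u 0 = u0)
  (u_sol : forall t : K, a < t < b -> is_derive t 1 u (F0 (u t) + F1 (u t)))
  (* the constants in the hypotheses on initial values and step sizes *)
  (K_init K_step : K) :
  exists C h0 : K, 0 < h0 /\
    forall (n : nat) (dt : nat -> K) (w : nat -> 'M[K]_(s, m)),
      (forall i : nat, (i <= n)%N -> 0 < dt i) ->
      tgrid dt n <= T ->
      dtmax dt n <= h0 ->
      (forall i : nat, (1 <= i <= n)%N ->
         sigma_min < step_ratio dt i < sigma_max) ->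
      (forall i : nat, (1 <= i <= n)%N ->
         `|dt i.-1 / dt i - 1| <= K_step * dtmax dt n) ->
      (forall i : 'I_s,
         `|row i (w 0%N) - u (tgrid dt 0 + c i 0 * dt 0%N)|
           <= K_init * dt 0%N ^+ s.+1) ->
      (forall i : nat, (1 <= i <= n)%N ->
         imex_peer_step c P R E2 F0 F1 dt w i) ->
      `|exact_stages u c dt n - w n| <= C * dtmax dt n ^+ s.+1.
Proof.
have [P_ones orders] := order_s.
have ker_trmx (v : 'cV[K]_s) : (1%:M - P)^T *m v = 0 ->
    (1%:M - P^T) *m v = 0 /\ v^T *m P = v^T.
  move=> kv; have kv' : (1%:M - P^T) *m v = 0 by rewrite -kv linearB/= trmx1.
  split=> //; apply/eqP; rewrite -subr_eq0 -oppr_eq0 opprB; apply/eqP.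
  rewrite -{1}[v^T]mulmx1 -mulmxBr -[1%:M - P]trmxK -trmx_mul kv.
  exact: trmx0.
have [alpha alphaP] : exists y, defect c P (peerQ c P R 1) R 1 s.+1 = (1%:M - P) *m y.
  apply: fredholm_alternative => v /ker_trmx[kv vP].
  by apply: defect1_orthogonal => //; [exact: cond_V|exact: cond_R].
have [beta betaP] : exists y, R *m extrap_defect c E2 1 = (1%:M - P) *m y.
  apply: fredholm_alternative => v /ker_trmx[kv vP].
  by apply: extrap_defect1_orthogonal => //; exact: cond_E.
have [M PM] := P_zero_stable.
have [L0 L00 F0L] := lipschitz_le F0_lipschitz.
have [L1 L10 F1L] := lipschitz_le F1_lipschitz.
have L_ge0 : 0 <= L0 + L1 by rewrite addr_ge0.
have {}F0L x y : `|F0 x - F0 y| <= (L0 + L1) * `|x - y|.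
  by rewrite (le_trans (F0L x y))// ler_wpM2r// lerDl.
have {}F1L x y : `|F1 x - F1 y| <= (L0 + L1) * `|x - y|.
  by rewrite (le_trans (F1L x y))// ler_wpM2r// lerDr.
have [L L_gt0 incL] := imex_increment_lipschitz c P R E2 L_ge0 F0L F1L.
have [phi phi0 phi_chain] : exists2 phi, phi 0%N = u & vderiv_chain a b s.+2 phi.
  by apply: smooth_vderiv_chain => l; exact: cont_diff_smooth.
have [gam gam0 gam_chain] :
    exists2 gam, gam 0%N = F0 \o u & vderiv_chain a b s.+1 gam.
  apply: smooth_vderiv_chain => l.
  by apply: cont_diff_comp_smooth => //; exact: cont_diffW.
have phi1E t : a < t < b -> phi 1%N t = F0 (phi 0%N t) + F1 (phi 0%N t).
  move=> tab; have du := u_sol t tab; have dut := @ex_derive _ _ _ _ _ _ _ du.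
  rewrite phi0 -(@derive_val _ _ _ _ _ _ _ du) derive_mx//; apply/rowP => l.
  rewrite mxE; have := (phi_chain l).1 0%N isT t tab; rewrite phi0 => dl.
  by rewrite (@derive_val _ _ _ _ _ _ _ dl).
have gam0E t : a < t < b -> gam 0%N t = F0 (phi 0%N t) by rewrite gam0 phi0.
(* Nodes outside [[0, 1]] push stages out of [[0, T]], so the estimates live on a compact interval
   with a margin on both sides. *)
pose a' := a / 2; pose b' := (T + b) / 2.
have aa' : a < a' by rewrite /a'; lra.
have bb' : b' < b by rewrite /b'; lra.
pose Z := `|c| + 1; have Z0 : 0 <= Z by rewrite addr_ge0.
have cZ : `|c| <= Z by rewrite lerDl.
have ceZ : `|c - ones K s| <= Z.
  rewrite (le_trans (ler_normB _ _))// lerD2l; apply: mx_norm_le => // i j.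
  by rewrite mxE normr1.
pose delta := Num.min (- a / 2) ((b - T) / 2).
have delta0 : 0 < delta by rewrite lt_min; apply/andP; split; lra.
have [deltaa deltab] : delta <= - a / 2 /\ delta <= (b - T) / 2.
  by rewrite /delta !ge_min !lexx orbT.
have Z1 : 0 < Z + 1 by rewrite ltr_wpDl.
(* The factor 2 allows for the old step [h / sigma <= 2 h]. *)
pose h1 := delta / (2 * (Z + 1)).
have h10 : 0 < h1 by rewrite divr_gt0// mulr_gt0.
have h1Z h : 0 <= h -> h <= h1 -> Z * (2 * h) <= delta.
  rewrite ler_pdivlMr ?mulr_gt0// => h0; apply: le_trans.
  by lra.
have tcin t (z : 'cV[K]_s) h i : `|z| <= Z -> 0 <= t <= T -> 0 <= h ->
    Z * h <= delta -> a' <= t + z i 0 * h <= b'.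
  move=> zZ /andP[t0 tT] h0 hd.
  have : `|z i 0 * h| <= delta.
    rewrite normrM (ger0_norm h0) (le_trans _ hd)// ler_wpM2r//.
    exact: le_trans (mx_norm_entry _ _ _) zZ.
  rewrite ler_norml => /andP[d1 d2]; rewrite /a' /b'.
  by apply/andP; split; lra.
have tin t : 0 <= t <= T -> a' <= t <= b'.
  by move=> /andP[t0 tT]; rewrite /a' /b'; apply/andP; split; lra.
(* A point of [V] is a triple of time, step size and step size ratio. *)
pose V (x : K * K * K) := [/\ 0 <= x.1.1 <= T, 0 <= x.1.2 <= h1,
  2^-1 <= x.2 <= 2 & sigma_min < x.2 < sigma_max].
have V_h x : V x -> 0 <= x.1.2 by case=> _ /andP[].
have V_sigma x : V x -> 2^-1 <= x.2 <= 2 by case.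
have V_t x : V x -> a' <= x.1.1 <= b' by case=> /tin.
have V_tc x : V x -> forall i, a' <= x.1.1 + c i 0 * x.1.2 <= b'.
  move=> [xT /andP[x0 xh] _ _] i; apply: tcin => //.
  by apply: le_trans (h1Z _ x0 xh); rewrite ler_wpM2l//; lra.
have V_tce x : V x -> forall i, a' <= x.1.1 + (c - ones K s) i 0 * (x.1.2 / x.2) <= b'.
  move=> [xT /andP[x0 xh] /andP[x1 x2] _] i; have x20 : 0 < x.2 by lra.
  apply: tcin => //; first by rewrite divr_ge0// ltW.
  apply: le_trans (h1Z _ x0 xh); rewrite ler_wpM2l// mulrC ler_wpM2r//.
  by rewrite -[leRHS]invrK lef_pV2 ?posrE ?invr_gt0.
have V_order x : V x -> forall j, (1 <= j <= s)%N ->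
    defect c P (peerQ c P R x.2) R x.2 j = 0.
  by move=> [_ _ _ /orders].
have [C1 C10 HC1] := @imex_residual_bigO K s m c P R E2 c_distinct P_ones alpha beta
  alphaP betaP F0 F1 phi gam a b a' b' Z aa' bb' Z0 cZ ceZ phi_chain gam_chain
  phi1E gam0E (K * K * K)%type V (fun x => x.1.1) (fun x => x.1.2) (fun x => x.2)
  V_h V_sigma V_t V_tc V_tce V_order.
pose eta t := alpha *m phi s.+1 t + beta *m gam s t.
have [B B0 [eta_bnd eta_lip]] : exists2 B : K, 0 <= B &
    (forall t, 0 <= t <= T -> `|eta t| <= B) /\
    (forall t t', 0 <= t <= T -> 0 <= t' <= T -> `|eta t - eta t'| <= B * `|t - t'|).
  have [B1 B10 [bnd1 lpz1]] := vderiv_chain_bounded_lipschitz aa' bb' phi_chain.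
  have [B2 B20 [bnd2 lpz2]] := vderiv_chain_bounded_lipschitz aa' bb' gam_chain.
  have mul1 (v : 'cV[K]_s) (y : 'rV[K]_m) x : `|y| <= x -> `|v *m y| <= `|v| * x.
    move=> yx; rewrite (le_trans (mulmx_norm_le _ _))// mul1r.
    by rewrite ler_wpM2l.
  exists (`|alpha| * B1 + `|beta| * B2); first by rewrite addr_ge0 ?mulr_ge0.
  split=> [t /tin tab|t t' /tin tab /tin tab'].
    by rewrite (le_trans (ler_normD _ _))// lerD ?mul1 ?bnd1 ?bnd2.
  rewrite /eta opprD addrACA -!mulmxBr (le_trans (ler_normD _ _))//.
  by rewrite mulrDl -!mulrA lerD ?mul1 ?lpz1 ?lpz2.
(* Needed because [dt_(i-1)^(s+1) = dt_i^(s+1) sigma_i^-(s+1)]. *)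
have [Cp Cp0 HCp] := @lip1XV K s.+1.
pose Ks := `|K_step|; have Ks0 : 0 <= Ks by exact: normr_ge0.
(* Variation of [eta] over one step, plus the change of the step size power times the bound of
   [eta]. *)
pose Cd := B + Cp * (2 * Ks) * B.
have Cd0 : 0 <= Cd by rewrite addr_ge0 ?mulr_ge0.
pose Cr := C1 * (1 + 2 * Ks).
have Cr0 : 0 <= Cr by rewrite mulr_ge0 ?addr_ge0 ?mulr_ge0.
have Ki0 : 0 <= `|K_init| by [].
have [C [h2 [h20 conv]]] := @peer_superconvergence K s m P M L B Cd Cr `|K_init|
  (T + 1) s.+1 PM L_gt0 B0 Cd0 Cr0 Ki0.
pose h3 := (2 * (Ks + 1))^-1.
have h30 : 0 < h3 by rewrite invr_gt0 mulr_gt0// ltr_wpDl.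
(* In turn: the stages stay in the interval, stability applies, the ratios lie in [[1/2, 2]], and
   the steps [dt_1, ..., dt_n] sum to at most [T + 1] although only [t_n <= T] is known. *)
exists C, (Num.min (Num.min h1 h2) (Num.min h3 1)); split.
  by rewrite !lt_min h10 h20 h30 ltr01.
move=> n dt w dt0 tT; rewrite !le_min => /andP[/andP[Hh1 Hh2] /andP[Hh3 Hh4]].
move=> hsig hstep hinit hw.
set H := dtmax dt n in Hh1 Hh2 Hh3 Hh4 hstep *.
have dtH i : (i <= n)%N -> dt i <= H by exact: dtmax_ge.
have H0 : 0 < H by exact: lt_le_trans (dt0 0%N (leq0n _)) (dtH 0%N (leq0n _)).
have tiT i : (i <= n)%N -> 0 <= tgrid dt i <= T.
  move=> ni; apply/andP; split.
    by apply: tgrid_ge0 => j ji; exact/dt0/ltnW/(leq_trans ji).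
  by apply: le_trans tT; apply: tgrid_le => // j jn; exact/dt0/ltnW.
have KsH : Ks * H <= 2^-1.
  apply: (@le_trans _ _ (Ks * h3)); first by rewrite ler_wpM2l.
  by rewrite /h3 ler_pdivrMr ?mulr_gt0 ?ltr_wpDl//; lra.
have ratio i : (i < n)%N -> 2^-1 <= step_ratio dt i.+1 <= 2 /\
    `|step_ratio dt i.+1 - 1| <= 2 * (Ks * H).
  move=> ni; apply: ratio_near1 => //; [exact/dt0/ltnW|exact: dt0|].
  apply: le_trans (hstep i.+1 ni) _; rewrite ler_wpM2r ?(ltW H0)//.
  exact: ler_norm.
have Vi i : (i < n)%N -> V (tgrid dt i.+1, dt i.+1, step_ratio dt i.+1).
  move=> ni; split=> /=; [exact: tiT| |by case: (ratio i ni)|exact: hsig].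
  by rewrite (ltW (dt0 _ ni)) (le_trans (dtH _ ni)).
(* One factor [dt i] is kept for summation over the grid; the other [s] are traded for [H]. *)
have HsM i : (i <= n)%N -> dt i ^+ s.+1 * H <= dt i * H ^+ s.+1.
  move=> ni; rewrite exprS -mulrA ler_wpM2l ?(ltW (dt0 _ ni))// exprSr.
  rewrite ler_wpM2r ?(ltW H0)// lerXn2r ?nnegrE ?(ltW H0) ?(ltW (dt0 _ ni))//.
  exact: dtH.
apply: (conv n dt (fun i => exact_stages u c dt i - w i) (fun i => eta (tgrid dt i)) H).
- by [].
- by move=> i ni; rewrite dt0// dtH.
- apply: (@le_trans _ _ (tgrid dt n.+1)).
    by rewrite /tgrid big_ord_recl lerDr ltW// dt0.
  by rewrite tgridS lerD// (le_trans (dtH _ (leqnn n))).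
- by move=> i ni; rewrite eta_bnd ?tiT.
- move=> i ni; have [sg1 sg2] := ratio i ni.
  have d1 := dt0 _ ni; have d0 := dt0 _ (ltnW ni).
  have -> : dt i ^+ s.+1 = dt i.+1 ^+ s.+1 * (step_ratio dt i.+1 ^+ s.+1)^-1.
    rewrite /step_ratio expr_div_n invf_div mulrCA mulfV ?mulr1//.
    by rewrite expf_neq0// gt_eqF.
  set rho := (_ ^+ _)^-1.
  have -> : dt i.+1 ^+ s.+1 *: eta (tgrid dt i.+1)
      - (dt i.+1 ^+ s.+1 * rho) *: eta (tgrid dt i) =
    dt i.+1 ^+ s.+1 *: ((eta (tgrid dt i.+1) - eta (tgrid dt i))
      - (rho - 1) *: eta (tgrid dt i)).
    rewrite -scalerA -scalerBr; congr (_ *: _).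
    by rewrite scalerBl scale1r opprB addrA subrK.
  rewrite normrZ ger0_norm ?exprn_ge0 ?(ltW d1)//.
  apply: (@le_trans _ _ (dt i.+1 ^+ s.+1 * (Cd * H))); last first.
    by rewrite mulrCA ler_wpM2l// HsM.
  rewrite ler_wpM2l ?exprn_ge0 ?(ltW d1)// (le_trans (ler_normB _ _))//.
  rewrite mulrDl lerD//.
    rewrite (le_trans (eta_lip _ _ (tiT _ ni) (tiT _ (ltnW ni))))//.
    rewrite ler_wpM2l// tgridS [_ + dt i]addrC addrK ger0_norm ?(ltW d0)//.
    exact/dtH/ltnW.
  rewrite normrZ mulrAC ler_pM ?eta_bnd ?tiT ?(ltnW ni)//.
  have := HCp _ sg1; rewrite expr1n invr1 => /le_trans; apply.
  by rewrite -mulrA ler_wpM2l// -mulrA.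
- move=> i ni /=; have [sg1 sg2] := ratio i ni.
  have d1 := dt0 _ ni; have d0 := dt0 _ (ltnW ni).
  have := HC1 _ (Vi i ni) => /=.
  rewrite phi0.
  have -> : stages c (dt i.+1) u (tgrid dt i.+1) = exact_stages u c dt i.+1 by [].
  have -> : stages (c - ones K s) (dt i.+1 / step_ratio dt i.+1) u (tgrid dt i.+1)
      = exact_stages u c dt i.
    have -> : dt i.+1 / step_ratio dt i.+1 = dt i.
      by rewrite /step_ratio /= invf_div mulrCA mulfV ?mulr1// gt_eqF.
    apply/matrixP => k l; rewrite !mxE tgridS; congr (u _ _ _).
    by ring.
  rewrite -/(eta _); set W := exact_stages u c dt i.+1; set Wp := exact_stages u c dt i.
  have wE : w i.+1 = P *m w i + dt i.+1 *:
      imex_increment c P R E2 F0 F1 (step_ratio dt i.+1) (w i) (w i.+1).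
    exact: hw.
  set Y := (X in `|X| <= _) => HY.
  (* The perturbation of the error recursion is the residual of the exact stages plus a difference
     of increments, which is Lipschitz in the errors. *)
  have -> : W - w i.+1 - P *m (Wp - w i)
      - dt i.+1 ^+ s.+1 *: ((1%:M - P) *m eta (tgrid dt i.+1)) =
    Y + dt i.+1 *: (imex_increment c P R E2 F0 F1 (step_ratio dt i.+1) Wp W
      - imex_increment c P R E2 F0 F1 (step_ratio dt i.+1) (w i) (w i.+1)).
    rewrite {1}wE /Y /imex_residual mulmxBr scalerBr.
    set I1 := imex_increment _ _ _ _ _ _ _ _ _.
    set I2 := imex_increment _ _ _ _ _ _ _ _ _.
    set N := _ *m (alpha *m _ + _); rewrite -/(eta _) -/N.
    move: (P *m Wp) (P *m w i) I1 I2 N => A1 A2 A3 A4 A5.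
    by apply/matrixP => k l; rewrite !mxE; ring.
  rewrite (le_trans (ler_normD _ _))// addrC mulrDr lerD//.
    rewrite normrZ ger0_norm ?(ltW d1)// ler_wpM2l ?(ltW d1)//.
    exact: incL.
  apply: (le_trans HY); rewrite /Cr.
  apply: (@le_trans _ _ (C1 * (dt i.+1 ^+ s.+1 * H * (1 + 2 * Ks)))).
    rewrite ler_wpM2l// -mulrA ler_wpM2l ?exprn_ge0 ?(ltW d1)// mulrDr mulr1.
    by rewrite lerD ?dtH// (le_trans sg2)//; lra.
  have -> : dt i.+1 * (C1 * (1 + 2 * Ks) * H ^+ s.+1) =
    C1 * (dt i.+1 * H ^+ s.+1 * (1 + 2 * Ks)) by ring.
  by rewrite ler_wpM2l// ler_wpM2r ?HsM// addr_ge0// mulr_ge0.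
- have Hp0 : 0 <= H ^+ s.+1 by rewrite exprn_ge0// ltW.
  apply: mx_norm_le => [|i j]; first by rewrite mulr_ge0.
  have -> : (exact_stages u c dt 0 - w 0%N) i j =
      - ((row i (w 0%N) - u (tgrid dt 0 + c i 0 * dt 0%N)) 0 j).
    by rewrite !mxE opprB.
  rewrite normrN (le_trans (mx_norm_entry _ _ _))// (le_trans (hinit i))//.
  have d0 := dt0 0%N (leq0n _).
  apply: (@le_trans _ _ (`|K_init| * dt 0%N ^+ s.+1)).
    by rewrite ler_wpM2r ?ler_norm ?exprn_ge0 ?(ltW d0).
  by rewrite ler_wpM2l// lerXn2r ?nnegrE ?(ltW d0) ?(ltW H0)// dtH.
Qed.
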